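(* Let $f\in V$ and let $\{\theta_m\}_{m\in\mathbb N}$ be a sequence of real numbers with $\theta_1\ge\theta_2\ge\cdots\ge0$ and $\lim_{m\to\infty}\theta_m=0$. Assume $\mathrm{var}_m(f)^{1/m}\le\theta_m$ for all $m\in\mathbb N$. Write $\mathcal B=\mathcal B(\{\theta_m\})$. Then: (i) $\mathscr L_f(\mathcal B)\subset\mathcal B$ and $\mathscr L_f:\mathcal B\to\mathcal B$ is a compact operator. (ii) $\Lambda_f=\sigma(\mathscr L_f:\mathcal B\to\mathcal B)\setminus\{0\}$, and for each $\lambda\in\Lambda_f$ the multiplicity of $\lambda$ as an eigenvalue of $\mathscr L_f:V\to V$ equals its multiplicity as an eigenvalue of $\mathscr L_f:\mathcal B\to\mathcal B$.
   Context: Let $N\ge2$ and let $\mathbf A$ be an $N\times N$ zero-one matrix that is aperiodic (some power $\mathbf A^k$, $k\ge1$, has all entries positive). Let $\Sigma_{\mathbf A}^+=\{\omega=(\omega_m)_{m\ge0}\in\{1,\dots,N\}^{\mathbb N\cup\{0\}}:\mathbf A(\omega_m\omega_{m+1})=1\ \forall m\ge0\}$ with the product topology, and $\sigma_{\mathbf A}$ the shift $(\sigma_{\mathbf A}\omega)_m=\omega_{m+1}$. For $\phi:\Sigma_{\mathbf A}^+\to\mathbb C$ and $m\ge0$ let $\mathrm{var}_m(\phi)=\sup|\phi(\omega)-\phi(\omega')|$, the sup over all $\omega,\omega'$ with $\omega_k=\omega'_k$ for $0\le k\le m-1$ (all pairs if $m=0$). $V$ is the set of $\phi:\Sigma_{\mathbf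 A}^+\to\mathbb C$ with $\mathrm{var}_m(\phi)^{1/m}\to0$ (super-continuous functions). For $\theta\in(0,1)$, $d_\theta(\omega,\omega')=\theta^{\min\{m:\omega_m\neq\omega'_m\}}$ ($0$ if $\omega=\omega'$), $F_\theta$ is the space of complex $d_\theta$-Lipschitz functions with norm $\|\phi\|_\theta=\|\phi\|_\infty+[\phi]_\theta$ ($[\phi]_\theta$ the Lipschitz constant); $V$ carries the locally convex topology generated by the norms $\|\cdot\|_\theta$, $\theta\in(0,1)$. For $f\in V$ the transfer operator is $(\mathscr L_f\phi)(\omega)=\sum_{\omega'\in\Sigma_{\mathbf A}^+:\sigma_{\mathbf A}\omega'=\omega}e^{f(\omega')}\phi(\omega')$, which maps $V$ into $V$. $\Lambda_f$ is the set of nonzero eigenvalues of $\mathscr L_f:V\to V$ (each has finite multiplicity). For such a sequence $\{\theta_m\}$, $\mathcal B(\{\theta_m\})=\{\phi\in V:\exists C\ge0,\ \mathrm{var}_m(\phi)\le C\theta_{m+1}^m\ \forall m\ge0\}$ (with the convention $\theta_1^0=1$), normed by $\|\phi\|_{\mathcal B}=\|\phi\|_\infty+\inf\{C\ge0:\mathrm{var}_m(\phi)\le C\theta_{m+1}^m\ \forall m\ge0\}$; it is a Banach space. $\sigma(T:E\to E)$ denotes the spectrum. *)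

(* Defs.v *)
From HB Require Import structures.
From mathcomp Require Import all_boot all_order all_algebra.
From mathcomp Require Import all_classical all_reals all_analysis.
From mathcomp Require Import complex.
Set Implicit Arguments. Unset Strict Implicit. Unset Printing Implicit Defensive.
Import Order.TTheory GRing.Theory Num.Theory.
Import numFieldNormedType.Exports.
Local Open Scope ring_scope.
Local Open Scope classical_set_scope.

(* The alphabet {1,...,N} is represented by 'I_N = {0,...,N-1}. *)

Definition zero_one_mx (N : nat) (A : 'M[int]_N) : Prop :=
  forall i j, A i j = 0 \/ A i j = 1.

Definition aperiodic_mx (N : nat) (A : 'M[int]_N) : Prop :=
  exists k : nat, (0 < k)%N /\ forall i j, 0 < (A ^+ k) i j.

Definition admissible (N : nat) (A : 'M[int]_N) (w : nat -> 'I_N) : Prop :=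
  forall m : nat, A (w m) (w m.+1) = 1.

Definition SigmaA (N : nat) (A : 'M[int]_N) :=
  {w : nat -> 'I_N | `[< admissible A w >]}.

Definition scons (N : nat) (a : 'I_N) (w : nat -> 'I_N) : nat -> 'I_N :=
  fun n => if n is n'.+1 then w n' else a.

(* the point a.w of Sigma_A^+ (meaningful when A(a w_0) = 1, which is
   exactly when a.w is admissible; default value w otherwise) *)
Definition prepend (N : nat) (A : 'M[int]_N) (a : 'I_N) (w : SigmaA A)
  : SigmaA A := insubd w (scons a (val w)).

Definition cnorm (R : realType) (z : R[i]) : R := @ComplexField.Normc.normc R z.

Definition cexp (R : realType) (z : R[i]) : R[i] :=
  ((expR (complex.Re z))%:C * ((cos (complex.Im z))%:C + 'i * (sin (complex.Im z))%:C))%C.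

Definition agree (N : nat) (m : nat) (w w' : nat -> 'I_N) : Prop :=
  forall k, (k < m)%N -> w k = w' k.

Definition var (R : realType) (N : nat) (A : 'M[int]_N) (m : nat)
  (phi : SigmaA A -> R[i]) : \bar R :=
  ereal_sup [set x | exists w w' : SigmaA A,
     agree m (val w) (val w') /\ x = (cnorm (phi w - phi w'))%:E].

(* phi \in V : var_m(phi)^{1/m} -> 0, i.e. for every e > 0, eventually
   var_m(phi)^{1/m} <= e, i.e. var_m(phi) <= e^m *)
Definition inV (R : realType) (N : nat) (A : 'M[int]_N)
  (phi : SigmaA A -> R[i]) : Prop :=
  forall e : R, 0 < e ->
    exists M : nat, forall m : nat, (M <= m)%N -> (var m phi <= (e ^+ m)%:E)%E.

Definition transfer (R : realType) (N : nat) (A : 'M[int]_N)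
  (f phi : SigmaA A -> R[i]) (w : SigmaA A) : R[i] :=
  \sum_(a < N | A a (val w 0%N) == 1) cexp (f (prepend a w)) * phi (prepend a w).

Definition Bconst (R : realType) (N : nat) (A : 'M[int]_N) (theta : nat -> R)
  (phi : SigmaA A -> R[i]) : set R :=
  [set C | 0 <= C /\ forall m : nat, (var m phi <= (C * theta m.+1 ^+ m)%:E)%E].

Definition inB (R : realType) (N : nat) (A : 'M[int]_N) (theta : nat -> R)
  (phi : SigmaA A -> R[i]) : Prop :=
  inV phi /\ Bconst theta phi !=set0.

Definition supnorm (R : realType) (N : nat) (A : 'M[int]_N)
  (phi : SigmaA A -> R[i]) : R :=
  sup (range (fun w => cnorm (phi w))).

Definition normB (R : realType) (N : nat) (A : 'M[int]_N) (theta : nat -> R)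
  (phi : SigmaA A -> R[i]) : R :=
  supnorm phi + inf (Bconst theta phi).

Definition compact_op (R : realType) (X : Type) (E : (X -> R[i]) -> Prop)
  (nrm : (X -> R[i]) -> R) (T : (X -> R[i]) -> (X -> R[i])) : Prop :=
  forall u : nat -> (X -> R[i]),
    (forall n, E (u n)) -> (exists K : R, forall n, nrm (u n) <= K) ->
    exists (s : nat -> nat) (psi : X -> R[i]),
      (forall k, (s k < s k.+1)%N) /\ E psi /\
      ((fun k => nrm (fun x => T (u (s k)) x - psi x)) @ \oo --> (0 : R)).

Definition resolvent_exists (R : realType) (X : Type) (E : (X -> R[i]) -> Prop)
  (nrm : (X -> R[i]) -> R) (T : (X -> R[i]) -> (X -> R[i])) (lam : R[i]) : Prop :=
  exists S : (X -> R[i]) -> (X -> R[i]),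
    (forall phi, E phi -> E (S phi)) /\
    (exists K : R, forall phi, E phi -> nrm (S phi) <= K * nrm phi) /\
    (forall phi, E phi -> S (fun x => lam * phi x - T phi x) = phi) /\
    (forall phi, E phi -> (fun x => lam * S phi x - T (S phi) x) = phi).

Definition spectrum (R : realType) (X : Type) (E : (X -> R[i]) -> Prop)
  (nrm : (X -> R[i]) -> R) (T : (X -> R[i]) -> (X -> R[i])) : set R[i] :=
  [set lam | ~ resolvent_exists E nrm T lam].

Definition nz_eigenvalue (R : realType) (X : Type) (E : (X -> R[i]) -> Prop)
  (T : (X -> R[i]) -> (X -> R[i])) (lam : R[i]) : Prop :=
  lam != 0 /\ exists phi, E phi /\ (exists x, phi x != 0) /\
    forall x, T phi x = lam * phi x.

Definition gen_eigenspace (R : realType) (X : Type) (E : (X -> R[i]) -> Prop)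
  (T : (X -> R[i]) -> (X -> R[i])) (lam : R[i]) : (X -> R[i]) -> Prop :=
  fun phi => E phi /\ exists k : nat,
    iter k (fun g x => lam * g x - T g x) phi = (fun _ => 0).

Definition has_dim (R : realType) (X : Type) (S : (X -> R[i]) -> Prop) (d : nat)
  : Prop :=
  exists b : 'I_d -> (X -> R[i]),
    (forall i, S (b i)) /\
    (forall c : 'I_d -> R[i],
        (forall x, \sum_(i < d) c i * b i x = 0) -> forall i, c i = 0) /\
    (forall phi, S phi -> exists c : 'I_d -> R[i],
        forall x, phi x = \sum_(i < d) c i * b i x).

Definition eig_multiplicity (R : realType) (X : Type) (E : (X -> R[i]) -> Prop)
  (T : (X -> R[i]) -> (X -> R[i])) (lam : R[i]) (d : nat) : Prop :=
  has_dim (gen_eigenspace E T lam) d.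

(* Main.v *)
(* On functions with [var_m phi <= C theta_(m+1)^m], the transfer operator L
   satisfies [var_m (L phi) <= D (var_(m+1) phi + |phi| theta_(m+1)^(m+1))] for
   m >= 1, hence gains a factor theta_(m+1) -> 0.  With equicontinuity
   (Arzela-Ascoli) this gives compactness on B.  Sampling a function at one point
   of each m-cylinder is a finite-rank approximation of the identity, and
   compactness turns the solvability of lam - L into that of the finite linear
   systems lam - L P_m; Riesz's lemma stabilises the kernels of (lam - L)^k.
   Finally, iterating the estimate above on [lam psi - L psi = phi] with phi in B
   and psi in V shows that psi is in B, since var_m psi decays faster than any
   exponential; so V and B have the same generalized eigenspaces for lam != 0. *)
Require Import Defs.
From HB Require Import structures.
From mathcomp Require Import all_boot all_order all_algebra.
From mathcomp Require Import all_classical all_reals all_analysis.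
From mathcomp Require Import complex.
From mathcomp Require Import ring.
Import Order.TTheory GRing.Theory Num.Theory.
Import numFieldNormedType.Exports.
Local Open Scope ring_scope.
Local Open Scope classical_set_scope.

(** * The modulus of a complex number and null sequences *)

Section ComplexNorm.
Context {R : realType}.
Implicit Types z w : R[i].

(** Sampling at cylinder points does not converge to the identity in the norm of B: the oscillation
    constant of the error need not become small, and only the sup norm tends to 0. The abstract
    argument therefore works with two norms. Compactness yields limits in the norm of B, and
    boundedness of the operator in the sup norm identifies them. The sequence [theta] may vanish
    from some index on. Functions in B are then constant on cylinders of that level, and finer
    cylinder functions need not lie in B. Sampling thus stops at the first zero weight, and every
    estimate that divides by a weight treats zero weights apart. Multiplicities are algebraic, that
    is, dimensions of unions of kernels of powers. Finiteness uses the stabilised power: finitely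
    many sample values of [phi], [(lam - L) phi] and so on then determine [phi]. *)

Lemma cnorm_ge0 z : 0 <= cnorm z.
Proof. by case: z => a b; rewrite /cnorm /= sqrtr_ge0. Qed.

Lemma cnorm0 : cnorm (0 : R[i]) = 0.
Proof. exact: ComplexField.Normc.normc0. Qed.

Lemma cnorm_eq0 z : cnorm z <= 0 -> z = 0.
Proof.
move=> z0; apply: ComplexField.Normc.eq0_normc.
by apply/eqP; rewrite eq_le z0 cnorm_ge0.
Qed.

Lemma cnorm_gt0 z : z != 0 -> 0 < cnorm z.
Proof. by move=> z0; rewrite ltNge; apply/negP => /cnorm_eq0/eqP; apply/negP. Qed.

Lemma cnormM z w : cnorm (z * w) = cnorm z * cnorm w.
Proof. exact: ComplexField.Normc.normcM. Qed.

Lemma cnormN z : cnorm (- z) = cnorm z.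
Proof. exact: normcN. Qed.

Lemma cnormV z : cnorm z^-1 = (cnorm z)^-1.
Proof. exact: ComplexField.Normc.normcV. Qed.

Lemma cnormD z w : cnorm (z + w) <= cnorm z + cnorm w.
Proof. exact: le_normcD. Qed.

Lemma cnormB z w : cnorm (z - w) <= cnorm z + cnorm w.
Proof. by rewrite -(cnormN w) cnormD. Qed.

Lemma cnorm_real (r : R) : cnorm (r%:C)%C = `|r|.
Proof. by rewrite /cnorm /= expr0n /= addr0 sqrtr_sqr. Qed.

Lemma cnorm1 : cnorm (1 : R[i]) = 1.
Proof. exact: ComplexField.Normc.normc1. Qed.

Lemma cnorm_sum (I : Type) (r : seq I) (P : pred I) (F : I -> R[i]) :
  cnorm (\sum_(i <- r | P i) F i) <= \sum_(i <- r | P i) cnorm (F i).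
Proof.
elim/big_rec2: _ => [|i y x _ yx]; first by rewrite cnorm0.
by apply: le_trans (cnormD _ _) _; rewrite lerD2l.
Qed.

End ComplexNorm.

Section NullSequences.
Context {R : realType}.
Implicit Types (h : nat -> R) (s : nat -> nat).

Lemma le_null_seq h (r : R) : (forall n, r <= h n) -> h @ \oo --> (0 : R) -> r <= 0.
Proof.
move=> rh h0; rewrite leNgt; apply/negP => r0.
have := cvgr_lt _ h0 _ r0.
by case=> n _ /(_ n (leqnn n)) /=; rewrite ltNge rh.
Qed.

Lemma null_seq_le h h' : (forall n, 0 <= h n <= h' n) ->
  h' @ \oo --> (0 : R) -> h @ \oo --> (0 : R).
Proof.
move=> hh h'0; apply: (squeeze_cvgr _ _ h'0); last exact: cvg_cst.
by near=> n; exact: hh.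
Unshelve. all: by end_near. Qed.

Lemma null_seqD h h' : h @ \oo --> (0 : R) -> h' @ \oo --> (0 : R) ->
  (fun n => h n + h' n) @ \oo --> (0 : R).
Proof. by move=> h0 h1; rewrite -[X in _ --> X](addr0 0); apply: cvgD. Qed.

Lemma null_seqZ (c : R) h : h @ \oo --> (0 : R) ->
  (fun n => c * h n) @ \oo --> (0 : R).
Proof. by move=> h0; rewrite -[X in _ --> X](mulr0 c); apply: cvgM h0; exact: cvg_cst. Qed.

Lemma incr_geq s : (forall k, (s k < s k.+1)%N) -> forall k, (k <= s k)%N.
Proof. by move=> hs; elim=> // k IH; apply: leq_ltn_trans IH (hs k). Qed.

Lemma null_seq_sub s h : (forall k, (k <= s k)%N) -> h @ \oo --> (0 : R) ->
  (fun k => h (s k)) @ \oo --> (0 : R).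
Proof.
move=> hs h0; apply: cvg_comp h0.
move=> P [n _ Pn]; exists n => // k /= nk.
by apply: Pn => /=; apply: leq_trans nk (hs k).
Qed.

Lemma null_seq_invS : (fun n => n.+1%:R^-1 : R) @ \oo --> (0 : R).
Proof. exact: cvg_harmonic. Qed.

Lemma null_seq_expr (q : R) : 0 <= q -> q < 1 -> (fun n => q ^+ n) @ \oo --> (0 : R).
Proof. by move=> q0 q1; apply: cvg_expr; rewrite ger0_norm. Qed.

End NullSequences.

(** * Riesz-Schauder theory on a space of functions *)

Definition lin2 {R : realType} {X : Type} (a : R[i]) (phi : X -> R[i])
  (b : R[i]) (psi : X -> R[i]) : X -> R[i] := fun x => a * phi x + b * psi x.

(** Convertible to the map iterated in [gen_eigenspace], so the generalized eigenspace is the union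
    of the kernels of its powers. *)
Definition shifted {R : realType} {X : Type} (T : (X -> R[i]) -> (X -> R[i]))
  (lam : R[i]) : (X -> R[i]) -> (X -> R[i]) := fun phi x => lam * phi x - T phi x.

Definition injective_on {R : realType} {X : Type} (E : (X -> R[i]) -> Prop)
  (S : (X -> R[i]) -> (X -> R[i])) : Prop :=
  forall phi, E phi -> (forall x, S phi x = 0) -> forall x, phi x = 0.

Section RieszTheory.
Context {R : realType} {X : Type}.
Variables (E : (X -> R[i]) -> Prop) (nrm : (X -> R[i]) -> R).
Variables (T : (X -> R[i]) -> (X -> R[i])) (K : R) (lam : R[i]).
Implicit Types (phi psi g : X -> R[i]).

Hypothesis E_lin2 : forall a b phi psi, E phi -> E psi -> E (lin2 a phi b psi).
Hypothesis nrm_ge0 : forall phi, 0 <= nrm phi.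
Hypothesis nrm_lin2 : forall a b phi psi, E phi -> E psi ->
  nrm (lin2 a phi b psi) <= cnorm a * nrm phi + cnorm b * nrm psi.
Hypothesis le_nrm : forall phi, E phi -> forall x, cnorm (phi x) <= nrm phi.
Hypothesis T_lin2 : forall a b phi psi,
  T (lin2 a phi b psi) = lin2 a (T phi) b (T psi).
Hypothesis T_sup : forall a phi, (forall x, cnorm (phi x) <= a) ->
  forall x, cnorm (T phi x) <= K * a.
Hypothesis T_stable : forall phi, E phi -> E (T phi).
Hypothesis T_compact : compact_op E nrm T.
Hypothesis lam_neq0 : lam != 0.

Lemma E_scale a phi : E phi -> E (fun x => a * phi x).
Proof.
move=> Ephi; rewrite (_ : (fun _ => _) = lin2 a phi 0 phi); first exact: E_lin2.
by apply/funext => x; rewrite /lin2 mul0r addr0.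
Qed.

Lemma E_sub phi psi : E phi -> E psi -> E (fun x => phi x - psi x).
Proof.
move=> Ep Eq; rewrite (_ : (fun _ => _) = lin2 1 phi (-1) psi); first exact: E_lin2.
by apply/funext => x; rewrite /lin2 mul1r mulN1r.
Qed.

Lemma nrm_scale a phi : E phi -> nrm (fun x => a * phi x) <= cnorm a * nrm phi.
Proof.
move=> Ephi; rewrite (_ : (fun _ => _) = lin2 a phi 0 phi).
  by apply: le_trans (nrm_lin2 _ _ _ _ Ephi Ephi) _; rewrite cnorm0 mul0r addr0.
by apply/funext => x; rewrite /lin2 mul0r addr0.
Qed.

Lemma nrm_zero phi : E phi -> (forall x, phi x = 0) -> nrm phi = 0.
Proof.
move=> Ephi phi0; apply/eqP; rewrite eq_le nrm_ge0 andbT.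
rewrite (_ : phi = (fun x => 0 * phi x)).
  by apply: le_trans (nrm_scale _ _ Ephi) _; rewrite cnorm0 mul0r.
by apply/funext => x; rewrite phi0 mul0r.
Qed.

Lemma nrm_gt0 phi x : E phi -> phi x != 0 -> 0 < nrm phi.
Proof. by move=> Ep /cnorm_gt0 h; apply: lt_le_trans h (le_nrm _ Ep x). Qed.

Lemma T_scale a phi : T (fun x => a * phi x) = fun x => a * T phi x.
Proof.
rewrite (_ : (fun x => a * phi x) = lin2 a phi 0 phi).
  by rewrite T_lin2; apply/funext => x; rewrite /lin2 mul0r addr0.
by apply/funext => x; rewrite /lin2 mul0r addr0.
Qed.

Lemma T_sub phi psi : T (fun x => phi x - psi x) = fun x => T phi x - T psi x.
Proof.
rewrite (_ : (fun _ => _) = lin2 1 phi (-1) psi).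
  by rewrite T_lin2; apply/funext => x; rewrite /lin2 mul1r mulN1r.
by apply/funext => x; rewrite /lin2 mul1r mulN1r.
Qed.

Local Notation S := (shifted T lam).

Lemma shifted_lin2 a b phi psi : S (lin2 a phi b psi) = lin2 a (S phi) b (S psi).
Proof.
by apply/funext => x; rewrite /shifted T_lin2 /lin2; ring.
Qed.

Lemma shifted_E phi : E phi -> E (S phi).
Proof. by move=> Ep; apply: E_sub; [exact: E_scale|exact: T_stable]. Qed.

(* Used with [v n = phi n] as well as with [v n] a finite-rank approximation of
   [phi n] that becomes exact only in the sup norm. *)
Lemma approximate_solutions (phi v g : nat -> X -> R[i]) (g0 : X -> R[i])
    (eps : nat -> R) (K' : R) :
  (forall n, E (phi n)) -> (forall n, E (v n)) -> (forall n, E (g n)) -> E g0 ->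
  (forall n, nrm (v n) <= K') ->
  (forall n x, cnorm (v n x - phi n x) <= eps n) -> eps @ \oo --> (0 : R) ->
  (fun n => nrm (fun x => g n x - g0 x)) @ \oo --> (0 : R) ->
  (forall n x, lam * phi n x - T (v n) x = g n x) ->
  exists (s : nat -> nat) (phi0 : X -> R[i]),
    [/\ forall k, (k <= s k)%N, E phi0,
      (fun k => nrm (fun x => phi (s k) x - phi0 x)) @ \oo --> (0 : R) &
      forall x, lam * phi0 x - T phi0 x = g0 x].
Proof.
move=> Ephi Ev Eg Eg0 vK vphi eps0 gg0 phig.
have [s [psi [/incr_geq sk [Epsi Tpsi]]]] := T_compact v Ev (ex_intro _ K' vK).
have gs := null_seq_sub _ _ sk gg0.
(* The equation [lam * phi n = g n + T (v n)] has a convergent right side along [s], which dictates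
   this limit. *)
pose phi0 x := lam^-1 * (g0 x + psi x).
have Egpsi : E (fun x => g0 x + psi x).
  rewrite (_ : (fun _ => _) = lin2 1 g0 1 psi); first exact: E_lin2.
  by apply/funext => x; rewrite /lin2 !mul1r.
have Ephi0 : E phi0 by exact: E_scale.
have phiE k x : phi (s k) x - phi0 x =
    lam^-1 * (g (s k) x - g0 x) + lam^-1 * (T (v (s k)) x - psi x).
  by rewrite -phig /phi0; field.
have phi_lim : (fun k => nrm (fun x => phi (s k) x - phi0 x)) @ \oo --> (0 : R).
  apply: (@null_seq_le _ _ (fun k => cnorm lam^-1 * (nrm (fun x => g (s k) x - g0 x) +
      nrm (fun x => T (v (s k)) x - psi x)))); last first.
    by apply: null_seqZ; apply: null_seqD.
  move=> k; rewrite nrm_ge0 /=.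
  rewrite (_ : (fun _ => _) = lin2 lam^-1 (fun x => g (s k) x - g0 x)
    lam^-1 (fun x => T (v (s k)) x - psi x)); last by apply/funext => x; exact: phiE.
  by rewrite mulrDr; apply: nrm_lin2; apply: E_sub => //; exact: T_stable.
exists s, phi0; split => // x.
(* [psi] is the limit of [T (v (s k))]. Since [v (s k)] is known to tend to [phi0] only uniformly,
   the identification goes through [T_sup]. *)
suff Tphi0 : T phi0 x - psi x = 0.
  by move/eqP : Tphi0; rewrite subr_eq0 => /eqP ->; rewrite /phi0; field.
apply: cnorm_eq0.
apply: (@le_null_seq _ (fun k => K * (nrm (fun x => phi (s k) x - phi0 x) + eps (s k)) +
  nrm (fun x => T (v (s k)) x - psi x))); last first.
  apply: null_seqD => //; apply: null_seqZ; apply: null_seqD => //.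
  exact: null_seq_sub.
move=> k.
have -> : T phi0 x - psi x = - T (fun x => v (s k) x - phi0 x) x +
    (T (v (s k)) x - psi x) by rewrite T_sub; ring.
apply: le_trans (cnormD _ _) _; rewrite cnormN; apply: lerD; last first.
  by apply: (le_nrm (fun x => T (v (s k)) x - psi x)); apply: E_sub => //; exact: T_stable.
apply: T_sup => y.
have -> : v (s k) y - phi0 y = (phi (s k) y - phi0 y) + (v (s k) y - phi (s k) y).
  by ring.
apply: le_trans (cnormD _ _) _; apply: lerD => //.
by apply: (le_nrm (fun x => phi (s k) x - phi0 x)); exact: E_sub.
Qed.

Lemma nrm_lim1_neq0 (phi : nat -> X -> R[i]) (s : nat -> nat) phi0 :
  (forall n, E (phi n)) -> (forall n, nrm (phi n) = 1) -> E phi0 ->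
  (fun k => nrm (fun x => phi (s k) x - phi0 x)) @ \oo --> (0 : R) ->
  ~ forall x, phi0 x = 0.
Proof.
move=> Ep p1 E0 h p0.
suff : (1 : R) <= 0 by rewrite ler10.
apply: (le_null_seq _ _ _ h) => k.
by rewrite -(p1 (s k)); under eq_fun do rewrite p0 subr0.
Qed.

Lemma normalize phi : E phi -> 0 < nrm phi ->
  let c := ((nrm phi)^-1)%:C%C in
  nrm (fun x => c * phi x) = 1 /\
  forall psi, E psi -> nrm (fun x => c * psi x) <= nrm psi / nrm phi.
Proof.
move=> Ephi n0 /=; set c := ((nrm phi)^-1)%:C%C.
have cE : cnorm c = (nrm phi)^-1 by rewrite cnorm_real ger0_norm // invr_ge0 ltW.
have h psi : E psi -> nrm (fun x => c * psi x) <= nrm psi / nrm phi.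
  by move=> Epsi; rewrite mulrC -cE; exact: nrm_scale.
split => //; apply/eqP; rewrite eq_le; apply/andP; split.
  by apply: le_trans (h _ Ephi) _; rewrite divff // gt_eqF.
have c0 : c != 0 by apply: contraTneq n0 => c0;
  move: cE; rewrite c0 cnorm0 => /esym/eqP; rewrite invr_eq0 => /eqP ->; rewrite ltxx.
(* [nrm_scale] is only an inequality; the lower bound comes from scaling back by [c^-1]. *)
have := nrm_scale c^-1 _ (E_scale c _ Ephi).
rewrite cnormV cE invrK; under eq_fun do rewrite mulKf //.
by rewrite ler_pMr.
Qed.

(** * Approximation of the identity in the sup norm *)

Section Approximation.
Variables (P : nat -> (X -> R[i]) -> (X -> R[i])) (eps : nat -> R).
Hypothesis P_scale : forall m a phi, P m (fun x => a * phi x) = fun x => a * P m phi x.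
Hypothesis P_E : forall m phi, E phi -> E (P m phi) /\ nrm (P m phi) <= nrm phi.
Hypothesis P_approx : forall m phi x, E phi ->
  cnorm (P m phi x - phi x) <= eps m * nrm phi.
Hypothesis eps_lim : eps @ \oo --> (0 : R).

(** If every constant and threshold failed, unit vectors with indices [m n >= n] would be almost
    annihilated; a limit from [approximate_solutions] is nonzero and lies in the kernel of
    [lam - T]. The constant does not depend on [m], which keeps solutions of the approximate
    equations bounded. *)
Lemma bounded_below : injective_on E S ->
  exists (c : R) (M : nat), 0 < c /\ forall m, (M <= m)%N ->
  forall phi, E phi -> c * nrm phi <= nrm (fun x => lam * phi x - T (P m phi) x).
Proof.
move=> inj; apply: contrapT => hno.
have bad n : exists mp : nat * (X -> R[i]), [/\ (n <= mp.1)%N, E mp.2 &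
    nrm (fun x => lam * mp.2 x - T (P mp.1 mp.2) x) < n.+1%:R^-1 * nrm mp.2].
  apply: contrapT => hn; apply: hno; exists n.+1%:R^-1, n; split.
    by rewrite invr_gt0.
  move=> m nm phi Ephi; rewrite leNgt; apply/negP => lt.
  by apply: hn; exists (m, phi).
have {bad} [mp hmp] := choice bad.
pose c n := ((nrm (mp n).2)^-1)%:C%C : R[i].
pose phi n x := c n * (mp n).2 x.
have n0 n : 0 < nrm (mp n).2.
  have [_ _ /(le_lt_trans (nrm_ge0 _))] := hmp n.
  by rewrite pmulr_rgt0 // invr_gt0.
have Emp n : E (mp n).2 by have [] := hmp n.
have Ephi n : E (phi n) by apply: E_scale.
have phi1 n : nrm (phi n) = 1 by have [] := normalize _ (Emp n) (n0 n).
have E0 : E (fun=> 0).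
  rewrite (_ : (fun=> 0) = fun x => 0 * phi 0%N x); first exact: E_scale.
  by apply/funext => x; rewrite mul0r.
pose m n := (mp n).1.
have ET n psi : E psi -> E (fun x => lam * psi x - T (P (m n) psi) x).
  by move=> Epsi; apply: E_sub; [exact: E_scale|apply: T_stable; apply (P_E _ _ Epsi).1].
have [||||s [phi0 [_ Ephi0 lim phi0E]]] := approximate_solutions phi
  (fun n => P (m n) (phi n)) (fun n x => lam * phi n x - T (P (m n) (phi n)) x) (fun=> 0)
  (fun n => eps (m n)) 1 Ephi (fun n => (P_E _ _ (Ephi n)).1)
  (fun n => ET n _ (Ephi n)) E0 _ _ _ _ (fun n x => erefl).
- by move=> n; rewrite -(phi1 n); apply (P_E _ _ (Ephi n)).2.
- by move=> n x; rewrite -[X in _ <= X]mulr1 -(phi1 n); apply: P_approx.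
- by apply: null_seq_sub eps_lim => k; have [] := hmp k.
- apply: null_seq_le null_seq_invS => n; rewrite nrm_ge0 /=.
  have [_ h] := normalize _ (Emp n) (n0 n).
  have := h _ (ET n _ (Emp n)); rewrite -/(c n) => {}h.
  rewrite (_ : (fun _ => _) =
      (fun x => c n * (lam * (mp n).2 x - T (P (m n) (mp n).2) x))); last first.
    by apply/funext => x; rewrite /phi P_scale T_scale; ring.
  by apply: le_trans h _; rewrite ler_pdivrMr //; have [_ _ /ltW] := hmp n; exact.
apply: (nrm_lim1_neq0 _ _ _ Ephi phi1 Ephi0 lim).
exact: inj.
Qed.

(** For large [m] the lower bound makes [lam - T P_m] injective, hence solvable; the solutions are
    bounded by [c^-1 * nrm g], and a limit of them solves the equation for [T]. *)
Lemma surjective_of_injective :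
  injective_on E S ->
  (forall m, injective_on E (shifted (fun phi => T (P m phi)) lam) ->
     forall g, E g -> exists2 phi, E phi & forall x, lam * phi x - T (P m phi) x = g x) ->
  forall g, E g -> exists2 phi, E phi & forall x, lam * phi x - T phi x = g x.
Proof.
move=> inj solve g Eg.
have [c [M [c0 cP]]] := bounded_below inj.
have sol n : exists phi, E phi /\ forall x, lam * phi x - T (P (M + n) phi) x = g x.
  have [|phi Ep pg] := solve (M + n)%N _ g Eg; last by exists phi.
  move=> phi Ep p0 x; apply: cnorm_eq0; apply: le_trans (le_nrm _ Ep x) _.
  have := cP _ (leq_addr n M) _ Ep; rewrite [leRHS]nrm_zero //; last first.
    by apply: E_sub; [exact: E_scale|apply: T_stable; apply (P_E _ _ Ep).1].
  by rewrite pmulr_rle0.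
have {sol} [phi phiP] := choice sol.
have Ephi n : E (phi n) := (phiP n).1.
have phiK n : nrm (phi n) <= c^-1 * nrm g.
  rewrite ler_pdivlMl //; apply: le_trans (cP _ (leq_addr n M) _ (Ephi n)) _.
  by under eq_fun do rewrite (phiP n).2.
have [|||s [phi0 [_ Ephi0 _ phi0E]]] := approximate_solutions phi
  (fun n => P (M + n) (phi n)) (fun=> g) g (fun n => `|eps (M + n)%N| * (c^-1 * nrm g))
  (c^-1 * nrm g) Ephi (fun n => (P_E _ _ (Ephi n)).1) (fun=> Eg) Eg
  (fun n => le_trans (P_E _ _ (Ephi n)).2 (phiK n)) _ _ _ (fun n => (phiP n).2).
- move=> n x; apply: le_trans (P_approx _ _ _ (Ephi n)) _.
  apply: le_trans (ler_wpM2l (normr_ge0 _) (phiK n)).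
  by apply: ler_wpM2r => //; exact: ler_norm.
- under eq_fun do rewrite mulrC.
  apply: null_seqZ; apply: (null_seq_sub (addn M) (fun n => `|eps n|)) => [k|].
    exact: leq_addl.
  by rewrite -[X in _ --> X](normr0 R); apply: cvg_norm.
- apply: null_seq_le null_seq_invS => n; rewrite nrm_ge0 /= nrm_zero ?invr_ge0 //.
    exact: E_sub.
  by move=> x; rewrite subrr.
- by exists phi0.
Qed.

(** Unit eigenfunctions [phi n] whose [n]-th approximation vanishes are bounded pointwise by
    [eps n], while compactness gives them a nonzero limit. With sampling for [P], finitely many
    values thus separate the eigenspace. *)
Lemma eigenspace_determined : exists m, forall phi, E phi ->
  (forall x, lam * phi x - T phi x = 0) -> (forall x, P m phi x = 0) ->
  forall x, phi x = 0.
Proof.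
apply: contrapT => hno.
have bad n : exists phi, [/\ E phi, nrm phi = 1,
    forall x, lam * phi x - T phi x = 0 & forall x, P n phi x = 0].
  apply: contrapT => hn; apply: hno; exists n => phi Ephi eig P0 x.
  apply/eqP; apply: contrapT => /negP px.
  have n0 := nrm_gt0 _ _ Ephi px.
  apply: hn; exists (fun x => ((nrm phi)^-1)%:C%C * phi x); split.
  - exact: E_scale.
  - by have [] := normalize _ Ephi n0.
  - by move=> y; rewrite T_scale mulrCA -mulrBr eig mulr0.
  - by move=> y; rewrite P_scale P0 mulr0.
have {bad} [phi phiP] := choice bad.
have Ephi n : E (phi n) by have [] := phiP n.
have phi1 n : nrm (phi n) = 1 by have [] := phiP n.
have E0 : E (fun=> 0).
  rewrite (_ : (fun=> 0) = fun x => 0 * phi 0%N x); first exact: E_scale.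
  by apply/funext => x; rewrite mul0r.
have [||||s [phi0 [sk Ephi0 lim _]]] := approximate_solutions phi phi (fun _ _ => 0)
  (fun=> 0) (fun=> 0) 1 Ephi Ephi (fun=> E0) E0 _ _ (@cvg_cst _ _ _ _ _) _ _.
- by move=> n; rewrite phi1.
- by move=> n x; rewrite subrr cnorm0.
- apply: null_seq_le null_seq_invS => n; rewrite nrm_ge0 /= nrm_zero ?invr_ge0 //.
    exact: E_sub.
  by move=> x; rewrite subrr.
- by move=> n x; have [_ _ ->] := phiP n.
apply: (nrm_lim1_neq0 _ _ _ Ephi phi1 Ephi0 lim) => x.
apply: cnorm_eq0.
apply: (@le_null_seq _ (fun k => eps (s k) + nrm (fun x => phi (s k) x - phi0 x))); last first.
  by apply: null_seqD => //; exact: null_seq_sub.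
move=> k; have -> : phi0 x = (0 - (P (s k) (phi (s k)) x - phi (s k) x)) - (phi (s k) x - phi0 x).
  by have [_ _ _ ->] := phiP (s k); ring.
rewrite sub0r; apply: le_trans (cnormB _ _) _; rewrite cnormN; apply: lerD.
  by rewrite -[leRHS]mulr1 -(phi1 (s k)); exact: P_approx.
by apply: (le_nrm (fun x => phi (s k) x - phi0 x)); exact: E_sub.
Qed.

End Approximation.

(** * Kernels of powers and Riesz's lemma *)

Definition iterated_kernel k phi := E phi /\ forall x, iter k S phi x = 0.
Local Notation W := iterated_kernel.

Lemma iter_shifted_lin2 k a b phi psi :
  iter k S (lin2 a phi b psi) = lin2 a (iter k S phi) b (iter k S psi).
Proof. by elim: k => //= k ->; rewrite shifted_lin2. Qed.

Lemma iterated_kernel_lin2 k a b phi psi : W k phi -> W k psi -> W k (lin2 a phi b psi).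
Proof.
move=> [Ep p0] [Eq q0]; split; first exact: E_lin2.
by move=> x; rewrite iter_shifted_lin2 /lin2 p0 q0 !mulr0 addr0.
Qed.

Lemma shifted_eq0 phi : (forall x, phi x = 0) -> forall x, S phi x = 0.
Proof.
move=> p0; have -> : phi = lin2 0 phi 0 phi.
  by apply/funext => x; rewrite /lin2 p0 !mulr0 addr0.
by move=> x; rewrite shifted_lin2 /lin2 !mul0r addr0.
Qed.

Lemma iterated_kernel_mono j k phi : (j <= k)%N -> W j phi -> W k phi.
Proof.
move=> /subnK <- [Ep p0]; split => //.
by elim: (k - j)%N => //= n IH; apply: shifted_eq0.
Qed.

Lemma iterated_kernel_shifted k phi : W k.+1 phi -> W k (S phi).
Proof.
by move=> [Ep p0]; split; [exact: shifted_E|move=> x; have := p0 x; rewrite iterSr].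
Qed.

Lemma iterated_kernel_T k phi : W k phi -> W k (T phi).
Proof.
move=> Wp; have -> : T phi = lin2 lam phi (-1) (S phi).
  by apply/funext => x; rewrite /lin2 /shifted; ring.
apply: iterated_kernel_lin2 => //; apply: iterated_kernel_shifted.
exact: iterated_kernel_mono Wp.
Qed.

(** Sup-norm continuity of the powers; it gives each function outside a kernel a positive distance
    from that kernel. *)
Lemma iter_shifted_sup k a phi : (forall x, cnorm (phi x) <= a) ->
  forall x, cnorm (iter k S phi x) <= (cnorm lam + K) ^+ k * a.
Proof.
move=> pa; elim: k => [|k IH] x; first by rewrite expr0 mul1r.
rewrite iterS {1}/shifted; apply: le_trans (cnormB _ _) _.
rewrite exprS mulrDl mulrDl; apply: lerD; last by rewrite -mulrA; apply: T_sup.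
by rewrite cnormM -mulrA ler_wpM2l // cnorm_ge0.
Qed.

Hypothesis K_ge0 : 0 <= K.

Lemma riesz_iterated_kernel k phi : W k.+1 phi -> ~ W k phi ->
  exists psi, [/\ W k.+1 psi, nrm psi = 1 &
    forall chi, W k chi -> 2^-1 <= nrm (fun x => psi x - chi x)].
Proof.
move=> Wp nWp; have Ep := Wp.1.
have [x0 x0P] : exists x, iter k S phi x != 0.
  apply: contrapT => hn; apply: nWp; split => // x; apply/eqP; apply: contrapT => /negP hx.
  by apply: hn; exists x.
have L0 : 0 < (cnorm lam + K) ^+ k.
  by rewrite exprn_gt0 // ltr_wpDr // cnorm_gt0.
pose D := [set r | exists2 psi, W k psi & r = nrm (fun x => phi x - psi x)].
(* Subtracting an element of [W k] from [phi] leaves [iter k S phi x0] unchanged, so it cannot bring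
   the norm below [del]. *)
pose del := cnorm (iter k S phi x0) / (cnorm lam + K) ^+ k.
have del0 : 0 < del by rewrite divr_gt0 // cnorm_gt0.
have Wsub j psi chi : W j psi -> W j chi -> W j (fun x => psi x - chi x).
  move=> W1 W2; rewrite (_ : (fun _ => _) = lin2 1 psi (-1) chi).
    exact: iterated_kernel_lin2.
  by apply/funext => x; rewrite /lin2 mul1r mulN1r.
have Dlb : lbound D del.
  move=> _ [psi Wpsi ->]; rewrite ler_pdivrMr // mulrC.
  have Esub : E (fun x => phi x - psi x) by apply: E_sub => //; exact: Wpsi.1.
  have := iter_shifted_sup k _ _ (le_nrm _ Esub) x0.
  rewrite (_ : (fun _ => _) = lin2 1 phi (-1) psi); last first.
    by apply/funext => x; rewrite /lin2 mul1r mulN1r.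
  by rewrite iter_shifted_lin2 {1}/lin2 Wpsi.2 mulr0 addr0 mul1r.
have W0 : W k (fun x => phi x - phi x).
  split; first exact: E_sub.
  have := @iterated_kernel_mono 0 k (fun x => phi x - phi x) (leq0n _) _.
  by case; [split => [|x /=]; [exact: E_sub|rewrite subrr]|].
have Dinf : has_inf D by split; [eexists; exists (fun x => phi x - phi x)|exists del].
have infdel : del <= inf D by apply: lb_le_inf => //; exact: Dinf.1.
have inf0 : 0 < inf D by exact: lt_le_trans del0 infdel.
(* The tolerance [inf D] gives [nrm eta < 2 * inf D], whence the constant 1/2 after
   normalization. *)
have [_ [psi Wpsi ->] lt2] := inf_adherent inf0 Dinf.
pose eta x := phi x - psi x.
have Weta : W k.+1 eta by apply: Wsub => //; exact: iterated_kernel_mono Wpsi.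
have infle chi : W k chi -> inf D <= nrm (fun x => eta x - chi x).
  move=> Wc; apply: ge_inf; first exact: Dinf.2.
  exists (lin2 1 psi 1 chi); first exact: iterated_kernel_lin2.
  by congr nrm; apply/funext => x; rewrite /lin2 /eta; ring.
have n0 : 0 < nrm eta.
  apply: lt_le_trans inf0 _; apply: le_trans (infle _ W0) _.
  by rewrite (_ : (fun _ => _) = eta) //; apply/funext => x; rewrite subrr subr0.
exists (fun x => ((nrm eta)^-1)%:C%C * eta x); split.
- rewrite (_ : (fun _ => _) = lin2 ((nrm eta)^-1)%:C%C eta 0 eta).
    exact: iterated_kernel_lin2.
  by apply/funext => x; rewrite /lin2 mul0r addr0.
- by have [] := normalize _ Weta.1 n0.
move=> chi Wc.
have Wc' : W k (fun x => (nrm eta)%:C%C * chi x).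
  rewrite (_ : (fun _ => _) = lin2 (nrm eta)%:C%C chi 0 chi); first exact: iterated_kernel_lin2.
  by apply/funext => x; rewrite /lin2 mul0r addr0.
have := infle _ Wc'.
set xi := fun x => _ * eta x - chi x.
have Exi : E xi by apply: E_sub; [apply: E_scale; exact: Weta.1|exact: Wc.1].
have ne0 : (nrm eta)%:C%C != 0 :> R[i].
  by apply: contra_neq (lt0r_neq0 n0) => /(congr1 (@complex.Re R)).
rewrite (_ : (fun _ => _) = fun x => (nrm eta)%:C%C * xi x); last first.
  apply/funext => x; rewrite /xi mulrBr mulrA.
  by rewrite -rmorphM /= divff ?mul1r ?gt_eqF.
have := nrm_scale (nrm eta)%:C%C _ Exi; rewrite cnorm_real gtr0_norm // => h1 h2.
have h3 := le_trans h2 h1.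
have lt3 : nrm eta < 2 * inf D by rewrite mulr2n mulrDl mul1r.
rewrite -(ler_pM2l n0); apply: le_trans h3.
by rewrite ler_pdivrMr // mulrC ltW.
Qed.

(** Otherwise Riesz's lemma gives unit vectors [psi k] in [W k.+1] at distance at least 1/2 from
    [W k]; their images under [T] stay [cnorm lam / 2] apart, against compactness. *)
Lemma iterated_kernel_stable : exists k, forall phi, W k.+1 phi -> W k phi.
Proof.
apply: contrapT => hno.
have bad k : exists psi, [/\ W k.+1 psi, nrm psi = 1 &
    forall chi, W k chi -> 2^-1 <= nrm (fun x => psi x - chi x)].
  apply: contrapT => hk; apply: hno; exists k => phi Wp.
  by apply: contrapT => nWp; apply: hk; exact: riesz_iterated_kernel nWp.
have {bad} [psi psiP] := choice bad.
have Wpsi k : W k.+1 (psi k) by have [] := psiP k.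
have Epsi k : E (psi k) := (Wpsi k).1.
have [|s [g [sS [Eg lim]]]] := T_compact psi Epsi.
  by exists 1 => n; have [_ ->] := psiP n.
suff : (2^-1 : R) <= 0 by rewrite invr_le0 lern0.
pose h k := nrm (fun x => T (psi (s k)) x - g x).
apply: (@le_null_seq _ (fun k => cnorm lam^-1 * h k.+1 + cnorm lam^-1 * h k)); last first.
  apply: null_seqD; apply: null_seqZ => //.
  exact: (null_seq_sub succn).
move=> k.
(* Chosen so that [psi (s k.+1) - chi] is [lam^-1] times the difference of the two images; [chi] is
   in [W (s k.+1)] because [s] increases strictly. *)
pose chi := lin2 lam^-1 (S (psi (s k.+1))) lam^-1 (T (psi (s k))).
have Wchi : W (s k.+1) chi.
  apply: iterated_kernel_lin2; first exact: iterated_kernel_shifted.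
  by apply: iterated_kernel_mono (sS k) _; exact: iterated_kernel_T.
have [_ _ /(_ _ Wchi)] := psiP (s k.+1); move/le_trans; apply.
rewrite (_ : (fun _ => _) = lin2 lam^-1 (fun x => T (psi (s k.+1)) x - g x)
   (- lam^-1) (fun x => T (psi (s k)) x - g x)); last first.
  by apply/funext => x; rewrite /lin2 /chi /lin2 /shifted; field.
rewrite -[X in _ + X * _](cnormN lam^-1); apply: nrm_lin2; apply: E_sub => //; exact: T_stable.
Qed.

End RieszTheory.

(** * Finite-dimensional linear algebra *)

(** Functions on [D] are encoded as row vectors, where a square matrix with trivial kernel is
    invertible. *)
Lemma surjective_of_injective_finite (F : fieldType) (D : finType)
    (h : (D -> F) -> (D -> F)) :
  (forall a b u v, h (fun d => a * u d + b * v d) = fun d => a * h u d + b * h v d) ->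
  (forall v, (forall d, h v d = 0) -> forall d, v d = 0) ->
  forall w, exists v, forall d, h v d = w d.
Proof.
move=> h_lin h_inj w.
pose fn (x : 'rV[F]_#|D|) d := x 0 (enum_rank d).
pose rv (u : D -> F) : 'rV[F]_#|D| := \row_j u (enum_val j).
have fnK u : fn (rv u) = u.
  by apply/funext => d; rewrite /fn mxE enum_rankK.
have rvK x : rv (fn x) = x.
  by apply/rowP => j; rewrite mxE /fn enum_valK.
pose g x := rv (h (fn x)).
have g_lin : linear g.
  move=> a x y; apply/rowP => j; rewrite !mxE.
  have -> : fn (a *: x + y) = fun d => a * fn x d + 1 * fn y d.
    by apply/funext => d; rewrite /fn !mxE mul1r.
  by rewrite h_lin mul1r.
pose G : {linear 'rV[F]_#|D| -> 'rV[F]_#|D|} :=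
  HB.pack g (GRing.isLinear.Build _ _ _ _ g g_lin).
have free : row_free (lin1_mx G).
  apply: inj_row_free => x; rewrite mul_rV_lin1 /= /g => gx0.
  have hx : h (fn x) = fun=> 0.
    by rewrite -[LHS]fnK gx0; apply/funext => d; rewrite /fn mxE.
  rewrite -[x]rvK; apply/rowP => j; rewrite !mxE.
  by apply: h_inj => d; rewrite hx.
exists (fn (rv w *m invmx (lin1_mx G))) => d.
rewrite -[h _]fnK -[rv (h _)]/(G _) -mul_rV_lin1 mulmxKV ?fnK //.
by rewrite -row_free_unit.
Qed.

Section LinearSubspaces.
Context {R : realType} {X : Type}.
Implicit Types (V : (X -> R[i]) -> Prop) (phi psi : X -> R[i]).

Definition lin2_closed V := forall a b phi psi, V phi -> V psi -> V (lin2 a phi b psi).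

Lemma lin2_closed_sum V d (c : 'I_d -> R[i]) (b : 'I_d -> X -> R[i]) :
  lin2_closed V -> V (fun=> 0) -> (forall i, V (b i)) ->
  V (fun x => \sum_(i < d) c i * b i x).
Proof.
move=> Vlin V0; elim: d c b => [|d IH] c b Vb.
  rewrite (_ : (fun _ => _) = fun=> 0) //.
  by apply/funext => x; rewrite big_ord0.
rewrite (_ : (fun _ => _) = lin2 (c ord0) (b ord0) 1
    (fun x => \sum_(i < d) c (lift ord0 i) * b (lift ord0 i) x)).
  by apply: Vlin => //; exact: IH.
by apply/funext => x; rewrite /lin2 mul1r big_ord_recl.
Qed.

(** The kernel of [l] has codimension one in [V]: subtracting [l phi / l phi0] times [phi0] projects
    onto it. *)
Lemma has_dim_extend V (l : (X -> R[i]) -> R[i]) phi0 d :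
  lin2_closed V ->
  (forall a b phi psi, l (lin2 a phi b psi) = a * l phi + b * l psi) ->
  V phi0 -> l phi0 != 0 ->
  has_dim (fun phi => V phi /\ l phi = 0) d -> has_dim V d.+1.
Proof.
move=> Vlin llin Vphi0 l0 [b [Vb [b_free b_span]]].
pose b' (i : 'I_d.+1) := if unlift ord0 i is Some j then b j else phi0.
have b'0 : b' ord0 = phi0 by rewrite /b' unlift_none.
have b'S j : b' (lift ord0 j) = b j by rewrite /b' liftK.
have sumE (c : 'I_d.+1 -> R[i]) x : \sum_(i < d.+1) c i * b' i x =
    c ord0 * phi0 x + \sum_(j < d) c (lift ord0 j) * b j x.
  by rewrite big_ord_recl b'0; under eq_bigr do rewrite b'S.
exists b'; split; [|split].
- by move=> i; rewrite /b'; case: unlift => // j; have [] := Vb j.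
- move=> c c0.
  pose psi x := \sum_(j < d) c (lift ord0 j) * b j x.
  have lpsi : l psi = 0.
    have [] // : V psi /\ l psi = 0.
    apply: (@lin2_closed_sum (fun phi => V phi /\ l phi = 0)) => //.
      move=> x y u v [Vu lu] [Vv lv]; split; first exact: Vlin.
      by rewrite llin lu lv !mulr0 addr0.
    have -> : (fun=> 0) = lin2 0 phi0 0 phi0.
      by apply/funext => x; rewrite /lin2 !mul0r addr0.
    by split; [exact: Vlin|rewrite llin !mul0r addr0].
  have c00 : c ord0 = 0.
    have : l (lin2 (c ord0) phi0 1 psi) = l (lin2 0 phi0 0 phi0).
      congr l; apply/funext => x.
      by rewrite /lin2 !mul0r addr0 mul1r /psi -sumE c0.
    rewrite !llin lpsi mulr0 !mul0r !addr0 => /eqP.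
    by rewrite mulf_eq0 (negbTE l0) orbF => /eqP.
  move=> i; case: (unliftP ord0 i) => [j ->|->]; last exact: c00.
  apply: (b_free (fun j => c (lift ord0 j)) _ j) => x.
  by have := c0 x; rewrite sumE c00 mul0r add0r.
- move=> phi Vphi.
  have [|c cP] := b_span (lin2 1 phi (- (l phi / l phi0)) phi0).
    by split; [exact: Vlin|rewrite llin mulNr divfK // mul1r subrr].
  exists (fun i => if unlift ord0 i is Some j then c j else l phi / l phi0) => x.
  rewrite sumE unlift_none; under eq_bigr do rewrite liftK.
  by rewrite -cP /lin2; ring.
Qed.

(** Induction on the list: restricting to the kernel of one functional lowers the dimension by at
    most one. *)
Lemma has_dim_of_functionals (I : eqType) (s : seq I) (l : I -> (X -> R[i]) -> R[i]) V :
  lin2_closed V ->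
  (forall i a b phi psi, l i (lin2 a phi b psi) = a * l i phi + b * l i psi) ->
  (forall phi, V phi -> (forall i, i \in s -> l i phi = 0) -> forall x, phi x = 0) ->
  exists d, has_dim V d.
Proof.
move=> + llin; elim: s V => [|i s IH] V Vlin V0.
  exists 0%N, (fun=> fun=> 0); split; [by case|split; first by move=> ? _ []].
  by move=> phi Vphi; exists (fun=> 0) => x; rewrite big_ord0 (V0 _ Vphi).
have [||d dimV'] := IH (fun phi => V phi /\ l i phi = 0).
- move=> a b u v [Vu lu] [Vv lv]; split; first exact: Vlin.
  by rewrite llin lu lv !mulr0 addr0.
- move=> phi [Vphi lphi] h; apply: V0 => // j; rewrite in_cons => /orP[/eqP -> //|]; exact: h.
have [[phi0 [Vphi0 l0]]|no] := pselect (exists phi, V phi /\ l i phi != 0).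
  by exists d.+1; exact: has_dim_extend Vphi0 l0 dimV'.
exists d; rewrite (_ : V = fun phi => V phi /\ l i phi = 0) //.
apply/funext => phi; apply/propext; split => [Vphi|[]//]; split => //.
by apply/eqP; apply: contrapT => /negP h; apply: no; exists phi.
Qed.

End LinearSubspaces.

(** * Equations for finite-rank sampling operators *)

Section FiniteRank.
Context {R : realType} {X : Type}.
Variables (E : (X -> R[i]) -> Prop) (T : (X -> R[i]) -> (X -> R[i])) (lam : R[i]).
Variables (D : finType) (r : D -> X) (code : X -> D).
Hypothesis E_lin2 : lin2_closed E.
Hypothesis T_lin2 : forall a b phi psi,
  T (lin2 a phi b psi) = lin2 a (T phi) b (T psi).
Hypothesis T_stable : forall phi, E phi -> E (T phi).
Hypothesis E_code : forall v : D -> R[i], E (v \o code).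
Hypothesis lam_neq0 : lam != 0.

(* A solution is determined by its samples [v = phi \o r], which solve a square
   linear system. *)
Lemma finite_rank_surjective :
  injective_on E (shifted (fun phi => T (phi \o r \o code)) lam) ->
  forall g, E g -> exists2 phi, E phi &
    forall x, lam * phi x - T (phi \o r \o code) x = g x.
Proof.
move=> inj g Eg.
have solE (g1 : X -> R[i]) v : E g1 -> E (fun x => lam^-1 * (g1 x + T (v \o code) x)).
  move=> Eg1; rewrite (_ : (fun _ => _) = lin2 lam^-1 g1 lam^-1 (T (v \o code))).
    by apply: E_lin2 => //; exact: T_stable.
  by apply/funext => x; rewrite /lin2 mulrDr.
have [|v0 v00|v vP] := @surjective_of_injective_finite _ D
    (fun v d => lam * v d - T (v \o code) (r d)) _ _ (g \o r).
- move=> a b u v; apply/funext => d.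
  have -> : (fun d => a * u d + b * v d) \o code = lin2 a (u \o code) b (v \o code) by [].
  by rewrite T_lin2 /lin2; ring.
- have E0 : E (fun=> 0).
    rewrite (_ : (fun=> 0) = lin2 0 g 0 g); first exact: E_lin2.
    by apply/funext => x; rewrite /lin2 !mul0r addr0.
  pose phi x := lam^-1 * (0 + T (v0 \o code) x).
  have phir : phi \o r = v0.
    apply/funext => d; apply: (mulfI lam_neq0); apply/eqP; rewrite -subr_eq0.
    rewrite /phi /= add0r mulVKf // -oppr_eq0 opprB.
    by apply/eqP; exact: v00.
  move=> d; rewrite -phir /=; apply: (inj phi); first exact: solE.
  by move=> x; rewrite /shifted phir /phi add0r mulVKf // subrr.
pose phi x := lam^-1 * (g x + T (v \o code) x).
have phir : phi \o r = v.
  apply/funext => d; have := vP d; rewrite /phi /= => <-.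
  by field.
exists phi; first exact: solE.
by move=> x; rewrite phir /phi mulVKf // addrK.
Qed.

End FiniteRank.

(** * Fredholm alternative and generalized eigenspaces *)

Section RieszSchauder.
Context {R : realType} {X : Type}.
Variables (E : (X -> R[i]) -> Prop) (nrm : (X -> R[i]) -> R).
Variables (T : (X -> R[i]) -> (X -> R[i])) (K : R) (lam : R[i]).
Variables (D : nat -> finType) (r : forall m, D m -> X) (code : forall m, X -> D m).
Variable (eps : nat -> R).
Implicit Types (phi psi g : X -> R[i]).

Hypothesis E_lin2 : lin2_closed E.
Hypothesis nrm_ge0 : forall phi, 0 <= nrm phi.
Hypothesis nrm_lin2 : forall a b phi psi, E phi -> E psi ->
  nrm (lin2 a phi b psi) <= cnorm a * nrm phi + cnorm b * nrm psi.
Hypothesis le_nrm : forall phi, E phi -> forall x, cnorm (phi x) <= nrm phi.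
Hypothesis T_lin2 : forall a b phi psi,
  T (lin2 a phi b psi) = lin2 a (T phi) b (T psi).
Hypothesis K_ge0 : 0 <= K.
Hypothesis T_sup : forall a phi, (forall x, cnorm (phi x) <= a) ->
  forall x, cnorm (T phi x) <= K * a.
Hypothesis T_stable : forall phi, E phi -> E (T phi).
Hypothesis T_compact : compact_op E nrm T.
Hypothesis lam_neq0 : lam != 0.
Hypothesis E_code : forall m (v : D m -> R[i]), E (v \o code m).
Hypothesis sample_nrm : forall m phi, E phi -> nrm (phi \o r m \o code m) <= nrm phi.
Hypothesis sample_approx : forall m phi x, E phi ->
  cnorm (phi (r m (code m x)) - phi x) <= eps m * nrm phi.
Hypothesis eps_lim : eps @ \oo --> (0 : R).

Lemma resolvent_of_injective :
  injective_on E (shifted T lam) -> resolvent_exists E nrm T lam.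
Proof.
move=> inj.
have surj : forall g, E g -> exists2 phi, E phi & forall x, lam * phi x - T phi x = g x.
  apply: (surjective_of_injective E nrm T K lam E_lin2 nrm_ge0 nrm_lin2 le_nrm T_lin2
    T_sup T_stable T_compact lam_neq0 (fun m phi => phi \o r m \o code m) eps) => //.
  - by move=> m phi Ep; split; [exact: E_code|exact: sample_nrm].
  - by move=> m; exact: finite_rank_surjective.
(* Taking the identity for [P] turns the lower bound into the norm bound on the inverse. *)
have [//|||//|c [M [c0 cP]]] := bounded_below E nrm T K lam E_lin2 nrm_ge0 nrm_lin2
    le_nrm T_lin2 T_sup T_stable T_compact lam_neq0 (fun _ phi => phi) (fun=> 0) _ _ _
    (@cvg_cst _ _ _ _ _).
- by [].
- by move=> _ phi x Ephi; rewrite subrr cnorm0 mul0r.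
have uniq phi psi : E phi -> E psi ->
    (forall x, lam * phi x - T phi x = lam * psi x - T psi x) -> phi = psi.
  move=> Ep Eq h; apply/funext => x; apply/eqP; rewrite -subr_eq0; apply/eqP.
  have /= := inj (lin2 1 phi (-1) psi) (E_lin2 _ _ _ _ Ep Eq) _ x.
  rewrite {2}/lin2 mul1r mulN1r; apply => y.
  have /eqP := h y; rewrite -subr_eq0 => /eqP <-.
  by rewrite /shifted T_lin2 /lin2; ring.
have /choice [G GP] : forall g, exists phi,
    E g -> E phi /\ forall x, lam * phi x - T phi x = g x.
  (* Outside [E] any value will do, since [resolvent_exists] constrains the inverse only on [E]. *)
  move=> g; have [Eg|nEg] := pselect (E g); last by exists g.
  by have [phi Ephi phiE] := surj g Eg; exists phi.
have ES phi : E phi -> E (fun x => lam * phi x - T phi x).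
  move=> Ep; rewrite (_ : (fun _ => _) = lin2 lam phi (-1) (T phi)).
    by apply: E_lin2 => //; exact: T_stable.
  by apply/funext => x; rewrite /lin2 mulN1r.
exists G; split; [|split; [|split]].
- by move=> phi /GP[].
- exists c^-1 => phi /GP[EG GE]; rewrite ler_pdivlMl //.
  apply: le_trans (cP _ (leqnn M) _ EG) _.
  by under eq_fun do rewrite GE.
- move=> phi Ephi; have [EG GE] := GP _ (ES _ Ephi).
  by apply: uniq.
- by move=> phi Ephi; apply/funext => x; exact: (GP _ Ephi).2.
Qed.

(** Applying the stable inclusion to [(lam - T)^j phi] removes one power at a time from an exponent
    [j + k]. *)
Lemma gen_eigenspace_iterated_kernel :
  exists k, forall phi, gen_eigenspace E T lam phi <-> iterated_kernel E T lam k phi.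
Proof.
have [k kP] := iterated_kernel_stable E nrm T K lam E_lin2 nrm_lin2
  le_nrm T_lin2 T_sup T_stable T_compact lam_neq0 K_ge0.
exists k => phi; split; last first.
  by move=> [Ep p0]; split => //; exists k; apply/funext => x; exact: p0.
move=> [Ep [j pj]].
have : iterated_kernel E T lam (j + k) phi.
  apply: (iterated_kernel_mono E T lam T_lin2 j); first exact: leq_addr.
  by split => // x; have := congr1 (fun h => h x) pj.
elim: j {pj} => // j IH; rewrite addSn => -[_ Wp]; apply: IH; split => // x.
have ES : E (iter j (shifted T lam) phi).
  by elim: j {Wp} => //= j; exact: shifted_E.
have iterC n y : iter (n + j) (shifted T lam) phi y =
    iter n (shifted T lam) (iter j (shifted T lam) phi) y by rewrite iterD.
rewrite addnC iterC; apply: (kP _ _).2; split => // y.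
by rewrite -iterC addSn addnC.
Qed.

(** The separating functionals are the samples of [phi], [S phi], ..., [S^(k-1) phi] at level [m],
    where [S = lam - T]. If they vanish, [S^(k-1) phi] is in the kernel of [S] with zero samples,
    hence 0, and descent on [k] gives [phi = 0]. *)
Lemma gen_eigenspace_has_dim : exists d, has_dim (gen_eigenspace E T lam) d.
Proof.
have [k kP] := gen_eigenspace_iterated_kernel.
have [|m mP] := eigenspace_determined E nrm T K lam E_lin2 nrm_ge0 nrm_lin2 le_nrm T_lin2
  T_sup T_stable T_compact lam_neq0 (fun m phi => phi \o r m \o code m) eps
  (fun _ _ _ => erefl) _ eps_lim.
  by move=> m phi x Ep; exact: sample_approx.
have -> : gen_eigenspace E T lam = iterated_kernel E T lam k.
  by apply/funext => phi; apply/propext.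
apply: (@has_dim_of_functionals R X (nat * D m)%type [seq (j, c) | j <- iota 0 k, c <- enum (D m)]
  (fun jc phi => iter jc.1 (shifted T lam) phi (r m jc.2))).
- by move=> a b phi psi; exact: iterated_kernel_lin2.
- by move=> jc a b phi psi; rewrite iter_shifted_lin2.
move=> phi Wphi h.
have {}h j c : (j < k)%N -> iter j (shifted T lam) phi (r m c) = 0.
  move=> jk; apply: (h (j, c)); apply/allpairsP; exists (j, c).
  by rewrite /= mem_iota mem_enum.
move: Wphi h => [Ephi]; elim: k {kP} => [p0 _ x|k IH p0 h]; first exact: p0.
apply: IH; last by move=> j c jk; apply: h; exact: ltnW.
apply: mP.
- by elim: k {p0 h} => //= k; exact: shifted_E.
- exact: p0.
- by move=> x; exact: h.
Qed.

End RieszSchauder.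

(** * Lipschitz bound for the complex exponential *)

Section ComplexExponential.
Context {R : realType}.

Lemma lipschitz_of_derivative (f df : R -> R) (L a b : R) :
  (forall x, is_derive x (1 : R) f (df x)) ->
  (forall x, Num.min a b <= x <= Num.max a b -> `|df x| <= L) ->
  `|f a - f b| <= L * `|a - b|.
Proof.
move=> fd; wlog ab : a b / a <= b.
  move=> h dfL; case: (leP a b) => [ab|/ltW ba]; first exact: h.
  by rewrite distrC (distrC a); apply: h => // x; rewrite minC maxC; exact: dfL.
rewrite min_l // max_r // => dfL; rewrite distrC (distrC a).
have [|c cab ->] := MVT_segment ab (fun x _ => fd x).
  by apply: derivable_within_continuous => x _; have [] := fd x.
by rewrite normrM ler_wpM2r // dfL // -in_itv.
Qed.

Lemma ler_abs_Re (z : R[i]) : `|complex.Re z| <= cnorm z.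
Proof.
case: z => a b /=; rewrite /cnorm /= -sqrtr_sqr ler_wsqrtr // lerDl sqr_ge0 //.
Qed.

Lemma ler_abs_Im (z : R[i]) : `|complex.Im z| <= cnorm z.
Proof.
case: z => a b /=; rewrite /cnorm /= -sqrtr_sqr ler_wsqrtr // lerDr sqr_ge0 //.
Qed.

Lemma cnormi : cnorm ('i%C : R[i]) = 1.
Proof. by rewrite /cnorm /= expr0n expr1n add0r sqrtr1. Qed.

Lemma cnorm_le_ReIm (z : R[i]) : cnorm z <= `|complex.Re z| + `|complex.Im z|.
Proof.
rewrite [in leLHS](complexE z); apply: le_trans (cnormD _ _) _.
by rewrite cnormM cnormi mul1r !cnorm_real.
Qed.

Lemma cnorm_cexp_phase (y : R) : cnorm ((cos y)%:C + 'i * (sin y)%:C)%C = 1.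
Proof.
rewrite /cnorm /= !mul0r !mul1r !subr0 !add0r !addr0.
by rewrite cos2Dsin2 sqrtr1.
Qed.

Lemma cnorm_cexp (z : R[i]) : cnorm (cexp z) = expR (complex.Re z).
Proof. by rewrite /cexp cnormM cnorm_cexp_phase mulr1 cnorm_real ger0_norm // expR_ge0. Qed.

(** Modulus and phase are varied separately: one [expR F] comes from the real exponential, two from
    the cosine and the sine of the imaginary part. *)
Lemma cexp_lipschitz (F : R) (z w : R[i]) : cnorm z <= F -> cnorm w <= F ->
  cnorm (cexp z - cexp w) <= 3 * expR F * cnorm (z - w).
Proof.
move=> zF wF.
set x := complex.Re z; set u := complex.Re w; set y := complex.Im z; set v := complex.Im w.
have xu : `|x - u| <= cnorm (z - w) by have := ler_abs_Re (z - w); rewrite raddfB.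
have yv : `|y - v| <= cnorm (z - w) by have := ler_abs_Im (z - w); rewrite raddfB.
have ReF (t : R[i]) : cnorm t <= F -> complex.Re t <= F.
  by move=> tF; apply: le_trans (le_trans (ler_abs_Re t) tF); exact: ler_norm.
have e1 : `|expR x - expR u| <= expR F * `|x - u|.
  apply: (lipschitz_of_derivative (@expR R) (@expR R)) => t.
  move=> /andP[_ tm]; rewrite ger0_norm ?expR_ge0 // ler_expR.
  by apply: le_trans tm _; rewrite ge_max !ReF.
have e2 : `|cos y - cos v| <= 1 * `|y - v|.
  apply: (lipschitz_of_derivative cos (fun t => - sin t)) => t.
  by move=> _; rewrite normrN sin_max.
have e3 : `|sin y - sin v| <= 1 * `|y - v|.
  apply: (lipschitz_of_derivative sin cos) => t.
  by move=> _; rewrite cos_max.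
have -> : cexp z - cexp w = (expR x - expR u)%:C%C * ((cos y)%:C + 'i * (sin y)%:C)%C +
    (expR u)%:C%C * ((cos y - cos v)%:C + 'i * (sin y - sin v)%:C)%C.
  rewrite /cexp -/x -/u -/y -/v !rmorphB /=; ring.
apply: le_trans (cnormD _ _) _; rewrite !cnormM cnorm_cexp_phase mulr1 !cnorm_real.
rewrite (ger0_norm (expR_ge0 u)).
have -> : 3 * expR F * cnorm (z - w) = expR F * cnorm (z - w) +
  expR F * (cnorm (z - w) + cnorm (z - w)) by ring.
apply: lerD; first by apply: le_trans e1 _; rewrite ler_wpM2l // expR_ge0.
apply: ler_pM; rewrite ?expR_ge0 ?cnorm_ge0 ?ler_expR ?ReF //.
apply: le_trans (cnormD _ _) _; rewrite cnorm_real; apply: lerD.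
  by apply: le_trans e2 _; rewrite mul1r.
rewrite cnormM cnorm_real cnormi mul1r; apply: le_trans e3 _.
by rewrite mul1r.
Qed.

End ComplexExponential.

(** * Oscillation on cylinders *)

Section Oscillation.
Context {R : realType} {N : nat} {A : 'M[int]_N}.
Local Notation X := (SigmaA A).
Implicit Types (phi psi : X -> R[i]) (w : X).

Definition osc_le m phi (c : R) := forall w w' : X,
  agree m (val w) (val w') -> cnorm (phi w - phi w') <= c.

Lemma var_leP m phi (c : R) : (var m phi <= c%:E)%E <-> osc_le m phi c.
Proof.
split => [h w w' ww'|h].
  rewrite -lee_fin; apply: le_trans h; apply: ereal_sup_ubound.
  by exists w, w'.
by apply: ge_ereal_sup => _ [w [w' [ww' ->]]]; rewrite lee_fin; exact: h.
Qed.

Lemma osc_le_trans m phi (c c' : R) : osc_le m phi c -> c <= c' -> osc_le m phi c'.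
Proof. by move=> h cc' w w' ww'; apply: le_trans cc'; exact: h. Qed.

Lemma osc_le_sup m phi (a : R) : (forall x, cnorm (phi x) <= a) -> osc_le m phi (2 * a).
Proof.
move=> pa w w' _; apply: le_trans (cnormB _ _) _.
by rewrite mulr2n mulrDl mul1r lerD.
Qed.

Lemma osc_le_lin2 m phi psi (c d : R) (a b : R[i]) : osc_le m phi c -> osc_le m psi d ->
  osc_le m (lin2 a phi b psi) (cnorm a * c + cnorm b * d).
Proof.
move=> pc pd w w' ww'.
have -> : lin2 a phi b psi w - lin2 a phi b psi w' =
    a * (phi w - phi w') + b * (psi w - psi w') by rewrite /lin2; ring.
apply: le_trans (cnormD _ _) _; rewrite !cnormM.
by apply: lerD; rewrite ler_wpM2l ?cnorm_ge0 //; [exact: pc|exact: pd].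
Qed.

Definition word m w : {ffun 'I_m -> 'I_N} := [ffun i : 'I_m => val w i].

Lemma agree_word m (w w' : X) : agree m (val w) (val w') <-> word m w = word m w'.
Proof.
split => [h|h k km].
  by apply/ffunP => i; rewrite !ffunE; exact: h.
by have := congr1 (fun c : {ffun _} => c (Ordinal km)) h; rewrite !ffunE.
Qed.

Variable x0 : X.

(** Words that begin no point get the default [x0], so that all words form one finite index type. *)
Definition cylinder_point m (c : {ffun 'I_m -> 'I_N}) : X := xget x0 [set w | word m w = c].

Lemma word_cylinder_point m w : word m (cylinder_point m (word m w)) = word m w.
Proof. rewrite /cylinder_point; case: xgetP => [y _ h|h]; [exact: h|by case: (h w)]. Qed.

Lemma agree_cylinder_point m w :
  agree m (val (cylinder_point m (word m w))) (val w).
Proof. by apply/agree_word; exact: word_cylinder_point. Qed.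

(** For [e = 1] the oscillation on cylinders of some level is at most 1, and there are finitely many
    such cylinders. *)
Lemma inV_bounded phi : inV phi -> exists a : R, 0 <= a /\ forall x, cnorm (phi x) <= a.
Proof.
move=> Vphi; have [M /(_ M (leqnn M)) /var_leP] := Vphi 1 ltr01.
rewrite expr1n => osc.
exists (\sum_(c : {ffun 'I_M -> 'I_N}) cnorm (phi (cylinder_point M c)) + 1).
have s0 : 0 <= \sum_(c : {ffun 'I_M -> 'I_N}) cnorm (phi (cylinder_point M c)).
  by apply: sumr_ge0 => c _; exact: cnorm_ge0.
split => [|x]; first exact: addr_ge0.
have -> : phi x = phi (cylinder_point M (word M x)) -
  (phi (cylinder_point M (word M x)) - phi x) by rewrite subKr.
apply: le_trans (cnormB _ _) _; apply: lerD; last first.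
  by apply: osc; exact: agree_cylinder_point.
rewrite (bigD1 (word M x)) //= lerDl; apply: sumr_ge0 => c _; exact: cnorm_ge0.
Qed.

Lemma inV_osc phi : inV phi <->
  forall e : R, 0 < e -> exists M, forall m, (M <= m)%N -> osc_le m phi (e ^+ m).
Proof.
by split => h e e0; have [M MP] := h e e0; exists M => m Mm; apply/var_leP; exact: MP.
Qed.

Lemma inV_of_osc phi (c : R) : 0 <= c ->
  (forall e : R, 0 < e -> exists M, forall m, (M <= m)%N -> osc_le m phi (c * e ^+ m)) ->
  inV phi.
Proof.
move=> c0 h; apply/inV_osc => e e0.
have c1 : 0 < 1 + c by rewrite ltr_pwDl.
(* Dividing by [1 + c] absorbs the constant, because [c <= (1 + c) ^+ m] for [m >= 1]; hence the
   threshold [M.+1]. *)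
have [M MP] := h (e / (1 + c)) (divr_gt0 e0 c1).
exists M.+1 => m Mm; apply: osc_le_trans (MP m (ltnW Mm)) _.
case: m Mm => // m _.
rewrite expr_div_n mulrCA ler_piMr ?exprn_ge0 ?ltW //.
rewrite ltr_pdivrMr ?exprn_gt0 // mul1r.
apply: lt_le_trans (_ : 1 + c <= _); first by rewrite ltrDr.
by rewrite -[leLHS]expr1 ler_weXn2l // lerDl.
Qed.

Lemma inV_lin2 : lin2_closed (@inV R N A).
Proof.
move=> a b phi psi /inV_osc Vphi /inV_osc Vpsi.
apply: (inV_of_osc _ (cnorm a + cnorm b)); first by rewrite addr_ge0 ?cnorm_ge0.
move=> e e0; have [M1 M1P] := Vphi e e0; have [M2 M2P] := Vpsi e e0.
exists (maxn M1 M2) => m; rewrite geq_max => /andP[h1 h2].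
by rewrite mulrDl; apply: osc_le_lin2; [exact: M1P|exact: M2P].
Qed.

End Oscillation.

(** * Sup-norm and oscillation estimates for the transfer operator *)

Section Transfer.
Context {R : realType} {N : nat} {A : 'M[int]_N}.
Local Notation X := (SigmaA A).
Implicit Types (f phi psi : X -> R[i]) (w : X).

Lemma transfer_lin2 f a b phi psi :
  transfer f (lin2 a phi b psi) = lin2 a (transfer f phi) b (transfer f psi).
Proof.
apply/funext => w; rewrite /lin2 /transfer !mulr_sumr -big_split /=.
by apply: eq_bigr => i _; ring.
Qed.

Lemma val_prepend a w : A a (val w 0%N) == 1 -> val (prepend a w) = scons a (val w).
Proof.
move=> /eqP h; rewrite /prepend insubdK //; apply/asboolP => -[|m] //=.
by have /asboolP := valP w; apply.
Qed.

Lemma agree_prepend m a (w w' : X) : A a (val w 0%N) == 1 -> A a (val w' 0%N) == 1 ->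
  agree m (val w) (val w') -> agree m.+1 (val (prepend a w)) (val (prepend a w')).
Proof.
by move=> h h' ww' [|k] km; rewrite !val_prepend //=; exact: ww'.
Qed.

Lemma sum_cnorm_le (P : pred 'I_N) (F : 'I_N -> R[i]) (c : R) : 0 <= c ->
  (forall i, P i -> cnorm (F i) <= c) -> cnorm (\sum_(i < N | P i) F i) <= N%:R * c.
Proof.
move=> c0 Fc; apply: le_trans (cnorm_sum _ _ _ _) _.
rewrite big_mkcond /=; apply: (@le_trans _ _ (\sum_(i < N) c)); last first.
  by rewrite sumr_const card_ord mulr_natl.
by apply: ler_sum => i _; case: ifP => // /Fc.
Qed.

Variables (f : X -> R[i]) (F : R).
Hypothesis f_le : forall x, cnorm (f x) <= F.
(** [N] bounds the number of preimages; [3 * expR F] bounds the weights and is also their Lipschitz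
    constant in [f]. *)
Let G := N%:R * (3 * expR F).

Lemma transfer_const_ge0 : 0 <= G.
Proof. by rewrite !mulr_ge0 // expR_ge0. Qed.

Lemma weight_le x : cnorm (cexp (f x)) <= 3 * expR F.
Proof.
rewrite cnorm_cexp; apply: (@le_trans _ _ (expR F)).
  by rewrite ler_expR; apply: le_trans (f_le x); apply: le_trans (ler_abs_Re _); exact: ler_norm.
by rewrite ler_peMl ?expR_ge0 // ler1n.
Qed.

Lemma transfer_sup phi (a : R) : (forall x, cnorm (phi x) <= a) ->
  forall x, cnorm (transfer f phi x) <= G * a.
Proof.
move=> pa x.
have a0 : 0 <= a by apply: le_trans (pa x); exact: cnorm_ge0.
rewrite -mulrA; apply: sum_cnorm_le; first by rewrite !mulr_ge0 // expR_ge0.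
move=> i _; rewrite cnormM; apply: ler_pM; rewrite ?cnorm_ge0 //; exact: weight_le.
Qed.

(** For [m >= 1], points that agree to level [m] share their first letter, so their preimages are
    indexed by the same letters and agree to level [m.+1]. *)
Lemma transfer_osc m phi (a b c : R) : (0 < m)%N -> 0 <= c -> 0 <= b ->
  (forall x, cnorm (phi x) <= a) ->
  osc_le m.+1 phi b -> osc_le m.+1 f c -> osc_le m (transfer f phi) (G * (b + a * c)).
Proof.
move=> m0 c0 b0 pa pb fc w w' ww'.
have a0 : 0 <= a by apply: le_trans (pa w); exact: cnorm_ge0.
rewrite /transfer -(ww' 0%N m0) -sumrB -mulrA; apply: sum_cnorm_le.
  by rewrite !mulr_ge0 ?addr_ge0 ?expR_ge0 ?mulr_ge0.
move=> i Ai.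
have Ai' : A i (val w' 0%N) == 1 by rewrite -(ww' 0%N m0).
have ag := agree_prepend _ _ _ _ Ai Ai' ww'.
set u := prepend i w in ag *; set v := prepend i w' in ag *.
have -> : cexp (f u) * phi u - cexp (f v) * phi v =
  cexp (f u) * (phi u - phi v) + (cexp (f u) - cexp (f v)) * phi v by ring.
apply: le_trans (cnormD _ _) _; rewrite (cnormM (cexp _)) (cnormM _ (phi v)) mulrDr; apply: lerD.
  by apply: ler_pM; rewrite ?cnorm_ge0 //; [exact: weight_le|exact: pb].
rewrite (mulrC a) mulrA; apply: ler_pM; rewrite ?cnorm_ge0 //.
apply: le_trans (cexp_lipschitz F _ _ (f_le u) (f_le v)) _.
by apply: ler_wpM2l; [rewrite mulr_ge0 // expR_ge0|exact: fc].
Qed.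

Lemma inV_transfer (x0 : X) phi : inV f -> inV phi -> inV (transfer f phi).
Proof.
move=> /inV_osc Vf Vphi.
have [a [a0 pa]] := inV_bounded x0 _ Vphi.
move/inV_osc : Vphi => Vphi.
apply: (inV_of_osc _ (G * (1 + a))); first by rewrite mulr_ge0 ?transfer_const_ge0 ?addr_ge0.
(* Capping at 1 gives [e1 ^+ m.+1 <= e ^+ m]. *)
move=> e e0; pose e1 := Num.min e 1.
have e10 : 0 < e1 by rewrite lt_min e0 ltr01.
have e1e : e1 <= e by rewrite ge_min lexx.
have e11 : e1 <= 1 by rewrite ge_min lexx orbT.
have [M1 M1P] := Vf e1 e10; have [M2 M2P] := Vphi e1 e10.
exists (maxn M1 M2).+1 => m Mm.
have m0 : (0 < m)%N by exact: leq_ltn_trans Mm.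
have /andP[h1 h2] : (M1 <= m.+1)%N && (M2 <= m.+1)%N.
  by rewrite -geq_max; exact: leqW (ltnW Mm).
have c0 : 0 <= e1 ^+ m.+1 by rewrite exprn_ge0 // ltW.
apply: osc_le_trans (transfer_osc m phi a _ _ m0 c0 c0 pa (M2P _ h2) (M1P _ h1)) _.
rewrite -mulrA; apply: ler_wpM2l; first exact: transfer_const_ge0.
rewrite mulrDl mul1r; have le : e1 ^+ m.+1 <= e ^+ m.
  apply: (@le_trans _ _ (e1 ^+ m)).
    by rewrite exprS ler_piMl ?exprn_ge0 // ltW.
  by rewrite lerXn2r ?nnegrE // ltW.
by rewrite lerD // ler_wpM2l.
Qed.

End Transfer.

(** * The space B and the transfer operator on it *)

Section SuperContinuousBanachSpace.
Context {R : realType} {N : nat} {A : 'M[int]_N}.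
Local Notation X := (SigmaA A).
Variables (theta : nat -> R) (x0 : X).
Implicit Types (phi psi : X -> R[i]) (w : X).
Hypothesis theta_mono : forall m : nat, (0 < m)%N -> theta m.+1 <= theta m.
Hypothesis theta_nneg : forall m : nat, (0 < m)%N -> 0 <= theta m.
Hypothesis theta_lim : theta @ \oo --> (0 : R).

(** The sequence is indexed from 1 and nothing is known about [theta 0], hence the shift here and
    below. *)
Lemma theta_ge0 m : 0 <= theta m.+1.
Proof. exact: theta_nneg. Qed.

Lemma theta_le_first m : theta m.+1 <= theta 1%N.
Proof. by elim: m => // m; apply: le_trans; exact: theta_mono. Qed.

Lemma theta_eventually_le (e : R) : 0 < e ->
  exists M, forall m, (M <= m)%N -> theta m.+1 <= e.
Proof.
move=> e0; have [M _ MP] := cvgr_lt _ theta_lim _ e0.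
by exists M => m Mm; apply/ltW/MP => /=; exact: leqW.
Qed.

Lemma theta_weight_ge0 m : 0 <= theta m.+1 ^+ m.
Proof. by rewrite exprn_ge0 ?theta_ge0. Qed.

(** Lets a sup-norm bound control the oscillation at finitely many levels; zero weights are excluded
    and enter the minimum as 1. *)
Lemma theta_weights_gt0 M : exists2 d : R, 0 < d &
  forall m, (m < M)%N -> theta m.+1 ^+ m != 0 -> d <= theta m.+1 ^+ m.
Proof.
elim: M => [|M [d d0 dP]]; first by exists 1.
pose t := if theta M.+1 ^+ M == 0 then 1 else theta M.+1 ^+ M.
exists (Num.min d t).
  rewrite lt_min d0 /t /=; case: eqVneq => // tM.
  by rewrite lt0r tM theta_weight_ge0.
move=> m; rewrite ltnS leq_eqVlt => /predU1P[->|mM] tm; rewrite ge_min.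
  by rewrite /t (negbTE tm) lexx orbT.
by rewrite dP.
Qed.

Lemma theta_weights_null : (fun m => theta m.+1 ^+ m) @ \oo --> (0 : R).
Proof.
have h0 : (0 : R) < 2^-1 by rewrite invr_gt0.
have [M MP] := theta_eventually_le _ h0.
rewrite -(cvg_shiftn M); apply: (null_seq_le _ (fun n => 2^-1 ^+ n)); last first.
  by apply: null_seq_expr; rewrite ?invr_ge0 // invf_lt1 // ltr1n.
move=> n /=; rewrite theta_weight_ge0 /=.
apply: (@le_trans _ _ (2^-1 ^+ (n + M))).
  by rewrite lerXn2r ?nnegrE ?theta_ge0 ?invr_ge0 // MP // leq_addl.
by apply: ler_wiXn2l; rewrite ?leq_addr ?invr_ge0 // invf_le1 // ler1n.
Qed.

(** The two parts of the norm are bounded separately because [transfer_small] combines a small sup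
    norm with an oscillation constant that is merely bounded. *)
Definition theta_bounded (a b : R) phi := (forall x, cnorm (phi x) <= a) /\
  forall m, osc_le m phi (b * theta m.+1 ^+ m).

Lemma theta_bounded_ge0 a b phi : theta_bounded a b phi -> 0 <= a.
Proof. by move=> [/(_ x0) h _]; apply: le_trans h; exact: cnorm_ge0. Qed.

Lemma theta_bounded_lin2 (c d : R[i]) phi psi a b a' b' :
  theta_bounded a b phi -> theta_bounded a' b' psi ->
  theta_bounded (cnorm c * a + cnorm d * a') (cnorm c * b + cnorm d * b') (lin2 c phi d psi).
Proof.
move=> [pa pb] [qa qb]; split => [x|m].
  by apply: le_trans (cnormD _ _) _; rewrite !cnormM lerD // ler_wpM2l ?cnorm_ge0.
by rewrite mulrDl -!mulrA; apply: osc_le_lin2.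
Qed.

Lemma theta_bounded_inB a b phi : 0 <= b -> theta_bounded a b phi ->
  inB theta phi /\ normB theta phi <= a + b.
Proof.
move=> b0 [pa pb].
have Bb : Bconst theta phi b by split => // m; apply/var_leP.
split; [split; [|by exists b]|].
  apply: (inV_of_osc _ b) => // e e0.
  have [M MP] := theta_eventually_le e e0; exists M => m Mm.
  apply: osc_le_trans (pb m) _; apply: ler_wpM2l => //.
  by rewrite lerXn2r ?nnegrE ?theta_ge0 ?(ltW e0) //; exact: MP.
apply: lerD.
  apply: ge_sup; first by exists (cnorm (phi x0)); exists x0.
  by move=> _ [x _ <-].
by apply: ge_inf => //; exists 0 => c [].
Qed.

(** True outside B as well, as the abstract theory asks, because [sup] is 0 on unbounded sets. *)
Lemma supnorm_ge0 phi : 0 <= supnorm phi.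
Proof.
rewrite /supnorm; set B := image _ _.
have [ubB|nub] := pselect (has_ubound B); last by rewrite sup_out // => -[_ /nub].
by apply: le_trans (ub_le_sup ubB (imageT _ x0)); exact: cnorm_ge0.
Qed.

Lemma inf_Bconst_ge0 phi : 0 <= inf (Bconst theta phi).
Proof.
have [B0|nB] := pselect (Bconst theta phi !=set0); last by rewrite inf_out // => -[/nB].
by apply: lb_le_inf => // c [].
Qed.

Lemma normB_ge0 phi : 0 <= normB theta phi.
Proof. by rewrite addr_ge0 ?supnorm_ge0 ?inf_Bconst_ge0. Qed.

(** The infimum in the norm is attained: a positive weight can be divided out, and at a zero weight
    every admissible constant already gives oscillation 0. *)
Lemma inB_theta_bounded phi : inB theta phi ->
  theta_bounded (supnorm phi) (inf (Bconst theta phi)) phi.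
Proof.
move=> [Vphi B0]; split => [x|m w w' ww'].
  have [a [_ pa]] := inV_bounded x0 _ Vphi.
  by apply: ub_le_sup; [exists a => _ [y _ <-]|exists x].
have h c : Bconst theta phi c -> cnorm (phi w - phi w') <= c * theta m.+1 ^+ m.
  by move=> [_ /(_ m) /var_leP]; exact.
have [t0|t0] := eqVneq (theta m.+1 ^+ m) 0.
  by have [c /h] := B0; rewrite t0 !mulr0.
have {}t0 : 0 < theta m.+1 ^+ m by rewrite lt0r t0 exprn_ge0 ?theta_ge0.
rewrite -ler_pdivrMr //; apply: lb_le_inf => // c /h.
by rewrite ler_pdivrMr.
Qed.

Lemma inB_theta_bounded_norm phi K : inB theta phi -> normB theta phi <= K ->
  theta_bounded K K phi.
Proof.
move=> Bphi nK; have [pa pb] := inB_theta_bounded _ Bphi; split => [x|m].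
  by apply: le_trans (pa x) (le_trans _ nK); rewrite lerDl inf_Bconst_ge0.
apply: osc_le_trans (pb m) _; rewrite ler_wpM2r ?theta_weight_ge0 //.
by apply: le_trans nK; rewrite lerDr supnorm_ge0.
Qed.

Lemma inB_lin2 : lin2_closed (@inB R N A theta).
Proof.
move=> c d phi psi Bphi Bpsi.
apply: (theta_bounded_inB _ _ _ _ (theta_bounded_lin2 c d _ _ _ _ _ _
  (inB_theta_bounded _ Bphi) (inB_theta_bounded _ Bpsi))).1.
by rewrite addr_ge0 // mulr_ge0 ?cnorm_ge0 ?inf_Bconst_ge0.
Qed.

Lemma normB_lin2 c d phi psi : inB theta phi -> inB theta psi ->
  normB theta (lin2 c phi d psi) <= cnorm c * normB theta phi + cnorm d * normB theta psi.
Proof.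
move=> Bphi Bpsi.
apply: le_trans (theta_bounded_inB _ _ _ _ (theta_bounded_lin2 c d _ _ _ _ _ _
  (inB_theta_bounded _ Bphi) (inB_theta_bounded _ Bpsi))).2 _.
  by rewrite addr_ge0 // mulr_ge0 ?cnorm_ge0 ?inf_Bconst_ge0.
by rewrite /normB !mulrDr addrACA.
Qed.

Lemma le_normB phi : inB theta phi -> forall x, cnorm (phi x) <= normB theta phi.
Proof.
by move=> Bphi; have [] := inB_theta_bounded_norm _ _ Bphi (lexx _).
Qed.


(* The truncation at the first vanishing weight keeps all cylinder functions of
   level [level m] inside the space, even when [theta] is eventually zero. *)
Definition level m := find (fun k => theta k.+1 ^+ k == 0) (iota 0 m).

Lemma level_le m : (level m <= m)%N.
Proof. by rewrite -[leqRHS](size_iota 0) find_size. Qed.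

Lemma level_weight_neq0 m k : (k < level m)%N -> theta k.+1 ^+ k != 0.
Proof.
move=> km; have := before_find 0%N km.
by rewrite nth_iota ?add0n => [->//|]; exact: leq_trans (level_le m).
Qed.

(** When the level is truncated, its weight is 0. *)
Lemma level_weight_le m : theta (level m).+1 ^+ level m <= theta m.+1 ^+ m.
Proof.
have [mm|] := eqVneq (level m) m; first by rewrite !mm.
rewrite neq_ltn => /orP[lm|]; last by rewrite ltnNge level_le.
have := @nth_find _ 0%N (fun k => theta k.+1 ^+ k == 0) (iota 0 m).
rewrite has_find size_iota => /(_ lm).
by rewrite nth_iota // add0n => /eqP ->; exact: theta_weight_ge0.
Qed.

Lemma level_weights_null : (fun m => theta (level m).+1 ^+ level m) @ \oo --> (0 : R).
Proof.
apply: null_seq_le theta_weights_null => m.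
by rewrite theta_weight_ge0 level_weight_le.
Qed.

Lemma osc_le_word m k (v : {ffun 'I_m -> 'I_N} -> R[i]) (c : R) : (m <= k)%N ->
  0 <= c -> osc_le k (v \o @word N A m) c.
Proof.
move=> mk c0 w w' ww'; rewrite /= (_ : word m w = word m w') ?subrr ?cnorm0 //.
by apply/agree_word => j jm; apply: ww'; exact: leq_trans mk.
Qed.

(** From the level on there is no oscillation; below it the weights are nonzero, so twice the sup
    bound divided by a lower bound [d] of these weights is an oscillation constant. *)
Lemma inB_word m (v : {ffun 'I_(level m) -> 'I_N} -> R[i]) :
  inB theta (v \o @word N A (level m)).
Proof.
have [d d0 dP] := theta_weights_gt0 (level m).
pose a := \sum_c cnorm (v c).
have va x : cnorm ((v \o @word N A (level m)) x) <= a.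
  rewrite /a (bigD1 (word (level m) x)) //= lerDl.
  by apply: sumr_ge0 => c _; exact: cnorm_ge0.
have a0 : 0 <= a by apply: sumr_ge0 => c _; exact: cnorm_ge0.
have b0 : 0 <= 2 * a / d by rewrite divr_ge0 ?mulr_ge0 // ltW.
apply: (theta_bounded_inB a _ _ b0 _).1; split => // k.
have [mk|km] := leqP (level m) k.
  by apply: osc_le_word => //; rewrite mulr_ge0 ?theta_weight_ge0.
apply: osc_le_trans (osc_le_sup k _ _ va) _.
rewrite mulrAC ler_pdivlMr // ler_wpM2l ?mulr_ge0 //.
by apply: dP => //; exact: level_weight_neq0 km.
Qed.

(** From level [m] on a sampled function has no oscillation; below it, the representatives of two
    points agree as far as the points do. *)
Lemma normB_sample m phi : inB theta phi ->
  normB theta (phi \o cylinder_point x0 m \o @word N A m) <= normB theta phi.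
Proof.
move=> Bphi; have [pa pb] := inB_theta_bounded _ Bphi.
have i0 := inf_Bconst_ge0 phi.
apply: (theta_bounded_inB _ _ _ i0 _).2; split => [x|k]; first exact: pa.
have [mk|km] := leqP m k.
  by apply: osc_le_word => //; rewrite mulr_ge0 ?theta_weight_ge0.
move=> w w' ww'; apply: pb => j jk.
have jm := ltn_trans jk km.
by rewrite !(agree_cylinder_point x0 m) // ww'.
Qed.

Lemma sample_approx m phi x : inB theta phi ->
  cnorm (phi (cylinder_point x0 m (word m x)) - phi x) <=
    theta m.+1 ^+ m * normB theta phi.
Proof.
move=> Bphi; rewrite mulrC.
have [_ pb] := inB_theta_bounded_norm _ _ Bphi (lexx _).
by apply: pb; exact: agree_cylinder_point.
Qed.

Section TransferOnB.
Variables (f : X -> R[i]) (F : R).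
Hypothesis f_le : forall x, cnorm (f x) <= F.
Hypothesis f_osc : forall m, osc_le m.+1 f (theta m.+1 ^+ m.+1).
Let G := N%:R * (3 * expR F).

Let G_ge0 : 0 <= G.
Proof. exact: transfer_const_ge0. Qed.

(** Preimages gain one level: by monotonicity both [phi] and [f] oscillate there with weight
    [theta m.+1 ^+ m.+1], one factor more than B requires. *)
Lemma transfer_osc_theta m phi a b : (0 < m)%N -> 0 <= b -> theta_bounded a b phi ->
  osc_le m (transfer f phi) (G * (a + b) * theta m.+1 * theta m.+1 ^+ m).
Proof.
move=> m0 b0 tb; have a0 := theta_bounded_ge0 _ _ _ tb; have [pa pb] := tb.
have t0 := theta_ge0 m.
have w0 k n : 0 <= theta n.+1 ^+ k by rewrite exprn_ge0 ?theta_ge0.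
apply: osc_le_trans (transfer_osc f F f_le m phi a _ _ m0 (w0 _ _) (mulr_ge0 b0 (w0 _ _))
  pa (pb m.+1) (f_osc m)) _.
rewrite (_ : G * (a + b) * _ * _ =
    G * (b * theta m.+1 ^+ m.+1 + a * theta m.+1 ^+ m.+1)); last first.
  by rewrite exprS; ring.
rewrite ler_wpM2l ?G_ge0 // lerD2r ler_wpM2l //.
by rewrite lerXn2r ?nnegrE ?theta_ge0 ?theta_mono.
Qed.

(** The summand [2 * (G * a)] serves [m = 0], where the two points may have preimages under
    different letters. *)
Lemma transfer_theta_bounded phi a b : 0 <= b -> theta_bounded a b phi ->
  theta_bounded (G * a) (G * (a + b) * theta 1%N + 2 * (G * a)) (transfer f phi).
Proof.
move=> b0 tb; have a0 := theta_bounded_ge0 _ _ _ tb; have [pa _] := tb.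
have Ta := transfer_sup f F f_le phi a pa.
split => // -[|m].
  apply: osc_le_trans (osc_le_sup 0 _ _ Ta) _.
  by rewrite expr0 mulr1 lerDr !mulr_ge0 ?addr_ge0 ?theta_ge0.
apply: osc_le_trans (transfer_osc_theta m.+1 phi a b _ b0 tb) _ => //.
rewrite ler_wpM2r ?theta_weight_ge0 // -[leLHS]addr0 lerD ?mulr_ge0 //.
by rewrite ler_wpM2l ?theta_le_first // mulr_ge0 ?addr_ge0.
Qed.

Lemma inB_transfer phi : inB theta phi -> inB theta (transfer f phi).
Proof.
move=> Bphi; have tb := inB_theta_bounded _ Bphi.
have s0 := supnorm_ge0 phi; have i0 := inf_Bconst_ge0 phi.
apply: (theta_bounded_inB _ _ _ _ (transfer_theta_bounded _ _ _ i0 tb)).1.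
by rewrite !addr_ge0 ?mulr_ge0 ?addr_ge0 ?theta_ge0.
Qed.

(* The factor [theta m.+1] gained in [transfer_osc_theta] handles the levels
   above some [M]; the finitely many others are controlled by the sup norm. *)
Lemma transfer_small b eta : 0 <= b -> 0 < eta -> exists2 eps : R, 0 < eps &
  forall phi, theta_bounded eps b phi -> normB theta (transfer f phi) <= eta.
Proof.
move=> b0 eta0.
pose e := eta / 2; have e0 : 0 < e by rewrite divr_gt0.
have c0 : 0 < G * (1 + b) + 1 by rewrite ltr_wpDl // mulr_ge0 // addr_ge0.
have [M MP] := theta_eventually_le _ (divr_gt0 e0 c0).
have [d d0 dP] := theta_weights_gt0 M.+1.
have g0 : 0 < 2 * G + 1 by rewrite ltr_wpDl // mulr_ge0.
(* The cap 1 keeps the constant of the high levels at most [G * (1 + b)]; the other two terms serve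
   the sup norm and the low levels. *)
pose eps := Num.min 1 (Num.min (e / (2 * G + 1)) (e * d / (2 * G + 1))).
have eps0 : 0 < eps by rewrite !lt_min ltr01 !divr_gt0 // mulr_gt0.
have eps1 : eps <= 1 by rewrite ge_min lexx.
have eps2 : (2 * G + 1) * eps <= e.
  by rewrite mulrC -ler_pdivlMr // !ge_min lexx !orbT.
have eps3 : (2 * G + 1) * eps <= e * d.
  by rewrite mulrC -ler_pdivlMr // !ge_min lexx !orbT.
have Geps : 2 * (G * eps) <= (2 * G + 1) * eps.
  by rewrite mulrA ler_wpM2r ?(ltW eps0) // lerDl.
exists eps => // phi tb; have [pa _] := tb.
have Ta := transfer_sup f F f_le phi eps pa.
have [|_] := theta_bounded_inB e e (transfer f phi) (ltW e0); last first.
  by move/le_trans; apply; rewrite /e -splitr.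
split => [x|m].
  apply: le_trans (Ta x) (le_trans _ eps2); apply: le_trans Geps.
  by rewrite ler_peMl ?ler1n // mulr_ge0 // ltW.
have small : (m < M.+1)%N -> theta m.+1 ^+ m != 0 ->
    osc_le m (transfer f phi) (e * theta m.+1 ^+ m).
  move=> mM tm; apply: osc_le_trans (osc_le_sup m _ _ Ta) _.
  apply: le_trans Geps (le_trans eps3 _).
  by rewrite ler_wpM2l ?(ltW e0) // dP.
case: m small => [|m] small; first by apply: small => //; rewrite expr0 oner_neq0.
have [mM|Mm] := ltnP m.+1 M.+1; last first.
  apply: osc_le_trans (transfer_osc_theta m.+1 phi _ _ _ b0 tb) _ => //.
  rewrite ler_wpM2r ?theta_weight_ge0 //.
  apply: (@le_trans _ _ ((G * (1 + b) + 1) * theta m.+2)).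
    rewrite ler_wpM2r ?theta_ge0 // -[leLHS]addr0 lerD // ler_wpM2l // lerD2r //.
  by rewrite mulrC -ler_pdivlMr // MP // ltnW.
(* A zero weight cannot be divided out, but there [transfer_osc_theta] already gives oscillation
   0. *)
have [t0|] := eqVneq (theta m.+2 ^+ m.+1) 0; last exact: small.
apply: osc_le_trans (transfer_osc_theta m.+1 phi _ _ _ b0 tb) _ => //.
by rewrite t0 !mulr0.
Qed.

End TransferOnB.
End SuperContinuousBanachSpace.

(** * Limits along ultrafilters *)

Section UltrafilterLimits.
Context {R : realType}.

Lemma ultra_bounded_limit (U : set_system nat) (h : nat -> R) (K : R) :
  UltraFilter U -> (forall n, `|h n| <= K) ->
  exists l : R, forall e : R, 0 < e -> U [set n | `|h n - l| <= e].
Proof.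
move=> UU hK.
(* The image of [U] clusters at some [l]; ultra-ness upgrades this to convergence. *)
have FF : ProperFilter (h @ U) by exact: fmap_proper_filter.
have [|l [_ cl]] := @segment_compact R (- K) K _ FF.
  rewrite /nbhs /=; apply: filterS (@filterT _ U _) => n _ /=.
  by rewrite in_itv /= -ler_norml.
exists l => e e0.
have [//|UC] := in_ultra_setVsetC [set n | `|h n - l| <= e] UU.
have [] := cl (h @` (~` [set n | `|h n - l| <= e])) (ball l e).
- by rewrite /nbhs /=; apply: filterS UC => n nC /=; exists n.
- exact: nbhsx_ballx.
- move=> _ [[n /= nC <-]]; rewrite /ball /= => lt.
  by exfalso; apply: nC; rewrite distrC ltW.
Qed.

Lemma ultra_bounded_limit_complex (U : set_system nat) (h : nat -> R[i]) (K : R) :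
  UltraFilter U -> (forall n, cnorm (h n) <= K) ->
  exists l : R[i], forall e : R, 0 < e -> U [set n | cnorm (h n - l) <= e].
Proof.
move=> UU hK.
have [a aP] := ultra_bounded_limit U (fun n => complex.Re (h n)) K UU
  (fun n => le_trans (ler_abs_Re (h n)) (hK n)).
have [b bP] := ultra_bounded_limit U (fun n => complex.Im (h n)) K UU
  (fun n => le_trans (ler_abs_Im (h n)) (hK n)).
exists (Complex a b) => e e0.
have e20 : 0 < e / 2 by rewrite divr_gt0.
apply: filterS (filterI (aP _ e20) (bP _ e20)) => n /= [an bn].
apply: le_trans (cnorm_le_ReIm _) _; rewrite [e]splitr.
by apply: lerD; move: an bn; case: (h n).
Qed.

End UltrafilterLimits.

(** * Compactness on B and regularity of solutions *)

Section Compactness.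
Context {R : realType} {N : nat} {A : 'M[int]_N}.
Local Notation X := (SigmaA A).
Variables (theta : nat -> R) (x0 : X).
Implicit Types (phi psi : X -> R[i]) (w : X).
Hypothesis theta_mono : forall m : nat, (0 < m)%N -> theta m.+1 <= theta m.
Hypothesis theta_nneg : forall m : nat, (0 < m)%N -> 0 <= theta m.
Hypothesis theta_lim : theta @ \oo --> (0 : R).

(** An ultrafilter gives limits at all points simultaneously, without a diagonal sequence.
    Convergence at the finitely many cylinder points of one level becomes uniform, since [u n] and
    [psi] oscillate by at most [e / 3] on those cylinders. *)
Lemma equicontinuous_ultra_limit (U : set_system nat) (u : nat -> X -> R[i]) (K : R) :
  UltraFilter U -> 0 <= K -> (forall n, theta_bounded theta K K (u n)) ->
  exists2 psi, theta_bounded theta K K psi &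
    forall e : R, 0 < e -> U [set n | forall x, cnorm (u n x - psi x) <= e].
Proof.
move=> UU K0 uK.
have [psi psiP] := choice (fun x => ultra_bounded_limit_complex U (u^~ x) K UU
  (fun n => (uK n).1 x)).
have psiK : theta_bounded theta K K psi.
  split => [x|m w w' ww'].
    apply/ler_addgt0Pr => e e0; have [n /= nP] := filter_ex (psiP x e e0).
    have -> : psi x = u n x - (u n x - psi x) by rewrite subKr.
    by apply: le_trans (cnormB _ _) _; apply: lerD => //; exact: (uK n).1.
  apply/ler_addgt0Pr => e e0; have e20 : 0 < e / 2 by rewrite divr_gt0.
  have [n /= [n1 n2]] := filter_ex (filterI (psiP w _ e20) (psiP w' _ e20)).
  have -> : psi w - psi w' = (u n w - u n w') - ((u n w - psi w) - (u n w' - psi w')).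
    by ring.
  apply: le_trans (cnormB _ _) _; apply: lerD; first exact: (uK n).2.
  by apply: le_trans (cnormB _ _) _; rewrite [e]splitr lerD.
exists psi => // e e0.
have e30 : 0 < e / 3 by rewrite divr_gt0.
have [m mP] : exists m, K * theta m.+1 ^+ m <= e / 3.
  have lim := null_seqZ K _ (theta_weights_null theta theta_nneg theta_lim).
  have [m _ /(_ m (leqnn m)) /= /ltW h] := cvgr_lt _ lim _ e30.
  by exists m.
have : U (fun n => forall c : {ffun 'I_m -> 'I_N},
    cnorm (u n (cylinder_point x0 m c) - psi (cylinder_point x0 m c)) <= e / 3).
  by apply: filter_forall => c; exact: psiP.
apply: filterS => n nP x; set y := cylinder_point x0 m (word m x).
have yx : agree m (val y) (val x) := agree_cylinder_point x0 m x.
have -> : u n x - psi x = (u n y - psi y) - ((u n y - u n x) - (psi y - psi x)) by ring.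
have -> : e = e / 3 + (e / 3 + e / 3) by field.
apply: le_trans (cnormB _ _) _; apply: lerD; first exact: nP.
apply: le_trans (cnormB _ _) _; apply: lerD; apply: le_trans mP.
  exact: (uK n).2.
exact: psiK.2.
Qed.

Variables (f : X -> R[i]) (F : R).
Hypothesis f_le : forall x, cnorm (f x) <= F.
Hypothesis f_osc : forall m, osc_le m.+1 f (theta m.+1 ^+ m.+1).

Lemma transfer_sub phi psi :
  transfer f (fun x => phi x - psi x) = fun x => transfer f phi x - transfer f psi x.
Proof.
rewrite (_ : (fun _ => _) = lin2 1 phi (-1) psi); last first.
  by apply/funext => x; rewrite /lin2 mul1r mulN1r.
by rewrite transfer_lin2; apply/funext => x; rewrite /lin2 mul1r mulN1r.
Qed.

Lemma transfer_compact : compact_op (inB theta) (normB theta) (transfer f).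
Proof.
move=> u Bu [K' uK'].
pose K := `|K'|.
have uK n : theta_bounded theta K K (u n).
  apply: (inB_theta_bounded_norm theta x0 theta_nneg _ _ (Bu n)).
  by apply: le_trans (uK' n) _; exact: ler_norm.
have K0 : 0 <= K by exact: normr_ge0.
have [U [UU oU]] := ultraFilterLemma eventually_filter.
have [psi psiK psiU] := equicontinuous_ultra_limit U u K UU K0 uK.
have Bpsi : inB theta psi.
  exact: (theta_bounded_inB theta x0 theta_nneg theta_lim K K psi K0 psiK).1.
pose d n := normB theta (fun x => transfer f (u n) x - transfer f psi x).
(* [U] contains all tails, so beyond [j] there are indices with [u n] uniformly close to [psi];
   [K + K] is an oscillation constant for the difference. *)
have near j (eta : R) : 0 < eta -> exists n, (j < n)%N /\ d n <= eta.
  move=> eta0.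
  have [|eps eps0 epsP] := transfer_small theta x0 theta_mono theta_nneg theta_lim
    f F f_le f_osc (K + K) eta _ eta0; first exact: addr_ge0.
  have Uj : U [set n | (j < n)%N] by apply: oU; exists j.+1.
  have [n /= [jn nP]] := filter_ex (filterI Uj (psiU eps eps0)).
  exists n; split => //; rewrite /d -transfer_sub; apply: epsP; split => //.
  have := (theta_bounded_lin2 theta 1 (-1) _ _ _ _ _ _ (uK n) psiK).2.
  rewrite cnormN cnorm1 !mul1r => h m.
  rewrite (_ : (fun _ => _) = lin2 1 (u n) (-1) psi) //.
  by apply/funext => x; rewrite /lin2 mul1r mulN1r.
have nearE (jk : nat * nat) : exists n, (jk.1 < n)%N /\ d n <= jk.2.+1%:R^-1.
  by apply: near; rewrite invr_gt0.
have [g gP] := choice nearE.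
pose s := fix s k := if k is k'.+1 then g (s k', k) else g (0%N, 0%N).
exists s, (transfer f psi); split; [|split].
- by move=> k; have [] := gP (s k, k.+1).
- exact: (inB_transfer theta x0 theta_mono theta_nneg theta_lim f F).
- apply: null_seq_le null_seq_invS => k.
  rewrite normB_ge0 //=; case: k => [|k].
    by have [] := gP (0%N, 0%N).
  by have [] := gP (s k, k.+1).
Qed.

(** Since [psi = lam^-1 * (S psi + L psi)] with [S = lam - L], the oscillation at level [m] is at
    most [D] times that at [m.+1] plus a term of the size allowed in B. Levels with
    [D * theta m.+1 > 2^-1] are finitely many and need only the sup bound. *)
Lemma inB_of_shifted (lam : R[i]) psi : lam != 0 -> inV psi ->
  inB theta (shifted (transfer f) lam psi) -> inB theta psi.
Proof.
move=> lam0 Vpsi BS.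
have [a [a0 pa]] := inV_bounded x0 _ Vpsi.
have [_ Sosc] := inB_theta_bounded theta x0 theta_nneg _ BS.
set C := inf _ in Sosc.
have C0 : 0 <= C by exact: inf_Bconst_ge0.
pose G := N%:R * (3 * expR F).
have G0 : 0 <= G by exact: transfer_const_ge0.
pose q := cnorm lam^-1.
have q0 : 0 <= q by exact: cnorm_ge0.
pose D := q * G + 1.
have D1 : 1 <= D by rewrite lerDr mulr_ge0.
have D0 : 0 < D by exact: lt_le_trans D1.
pose C' := q * (C + G * (a * theta 1%N)).
have t0 m : 0 <= theta m.+1 by exact: theta_ge0.
have W0 m k : 0 <= theta m.+1 ^+ k by rewrite exprn_ge0.
have C'0 : 0 <= C' by rewrite mulr_ge0 // addr_ge0 // mulr_ge0 // mulr_ge0.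
have step m b : (0 < m)%N -> 0 <= b -> osc_le m.+1 psi b ->
    osc_le m psi (D * b + C' * theta m.+1 ^+ m).
  move=> m0 b0 pb w w' ww'.
  have -> : psi w - psi w' = lam^-1 * ((shifted (transfer f) lam psi w -
     shifted (transfer f) lam psi w') + (transfer f psi w - transfer f psi w')).
    by rewrite /shifted; field.
  rewrite cnormM; apply: (@le_trans _ _ (q * (C * theta m.+1 ^+ m +
      G * (b + a * theta m.+1 ^+ m.+1)))).
    rewrite ler_wpM2l //; apply: le_trans (cnormD _ _) _; apply: lerD; first exact: Sosc.
    exact: (transfer_osc f F f_le m psi a b _ m0 (W0 _ _) b0 pa pb (f_osc m)).
  apply: (@le_trans _ _ (q * (C * theta m.+1 ^+ m +
      G * (b + a * (theta 1%N * theta m.+1 ^+ m))))).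
    rewrite ler_wpM2l // lerD2l ler_wpM2l // lerD2l ler_wpM2l // exprS.
    by rewrite ler_wpM2r // theta_le_first.
  rewrite (_ : q * _ = q * G * b + C' * theta m.+1 ^+ m); last by rewrite /C'; ring.
  by rewrite lerD2r ler_wpM2r // lerDl.
(* The inhomogeneous terms are dominated by a geometric series of ratio 1/2, whose sum is the factor
   2; monotonicity carries the ratio bound to [m.+1]. *)
have iterate n m b : (0 < m)%N -> 0 <= b -> D * theta m.+1 <= 2^-1 ->
    osc_le (m + n) psi b -> osc_le m psi (D ^+ n * b + 2 * C' * theta m.+1 ^+ m).
  elim: n m b => [|n IH] m b m0 b0 Dm.
    rewrite addn0 expr0 mul1r => /osc_le_trans; apply.
    by rewrite lerDl; apply: mulr_ge0 => //; exact: mulr_ge0.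
  rewrite -addSnnS => pb.
  have Dm' : D * theta m.+2 <= 2^-1.
    by apply: le_trans Dm; rewrite ler_wpM2l ?(ltW D0) ?theta_mono.
  have b1 : 0 <= D ^+ n * b + 2 * C' * theta m.+2 ^+ m.+1.
    apply: addr_ge0; first by apply: mulr_ge0 => //; rewrite exprn_ge0 // ltW.
    by apply: mulr_ge0 => //; exact: mulr_ge0.
  apply: osc_le_trans (step m _ m0 b1 (IH m.+1 b isT b0 Dm' pb)) _.
  rewrite mulrDr mulrA -exprS -addrA lerD2l.
  rewrite (_ : 2 * C' * theta m.+1 ^+ m =
    C' * theta m.+1 ^+ m + C' * theta m.+1 ^+ m); last by ring.
  rewrite lerD2r.
  apply: (@le_trans _ _ (2 * C' * ((D * theta m.+1) * theta m.+1 ^+ m))).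
    rewrite (_ : 2 * C' * (D * _ * _) = D * (2 * C' * theta m.+1 ^+ m.+1)); last first.
      by rewrite exprS; ring.
    rewrite ler_wpM2l ?(ltW D0) // ler_wpM2l //; first exact: mulr_ge0.
    by rewrite lerXn2r ?nnegrE ?theta_mono.
  rewrite mulrA ler_wpM2r // (mulrC 2) -mulrA -[leRHS]mulr1 ler_wpM2l //.
  by rewrite mulrC -ler_pdivlMr // mul1r.
pose e := (2 * D)^-1.
have e0 : 0 < e by rewrite invr_gt0 mulr_gt0.
have e1 : e <= 1.
  rewrite invf_le1 ?mulr_gt0 //; apply: le_trans D1 _.
  by rewrite ler_peMl ?(ltW D0) // ler1n.
(* [iterate] costs a factor [D ^+ n], beaten by the decay [e ^+ (m + n)] of [psi]. *)
have [M MP] := (inV_osc psi).1 Vpsi e e0.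
have high m : (0 < m)%N -> D * theta m.+1 <= 2^-1 ->
    osc_le m psi (2 * C' * theta m.+1 ^+ m).
  move=> m0 Dm w w' ww'; rewrite -subr_le0.
  have q1 : (2^-1 : R) < 1 by rewrite invf_lt1 // ltr1n.
  apply: (le_null_seq (fun k => 2^-1 ^+ k)); last by apply: null_seq_expr; rewrite ?invr_ge0.
  move=> k; rewrite lerBlDr.
  have Mk : (M <= m + (k + M))%N by rewrite addnA leq_addl.
  have ek0 : 0 <= e ^+ (m + (k + M)) by rewrite exprn_ge0 // ltW.
  apply: le_trans (iterate (k + M)%N m _ m0 ek0 Dm (MP _ Mk) _ _ ww') _.
  rewrite lerD2r (exprD e m) mulrCA -exprMn.
  have -> : D * e = 2^-1 by rewrite /e invfM mulrC mulfVK // gt_eqF.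
  apply: (@le_trans _ _ (2^-1 ^+ (k + M))).
    by rewrite ler_piMl ?exprn_ge0 ?invr_ge0 // exprn_ile1 // ltW.
  by rewrite ler_wiXn2l ?leq_addr ?invr_ge0 // ltW.
have [|M1 M1P] := theta_eventually_le theta theta_lim ((2 * D)^-1); first exact: e0.
have [d d0 dP] := theta_weights_gt0 theta theta_nneg M1.
(* The summands serve the positive levels where [D * theta m.+1] is small, the remaining positive
   levels, and [m = 0], in this order. *)
pose b := 2 * C' + (2 * a / d + 2 * a).
have ad0 : 0 <= 2 * a / d by rewrite divr_ge0 ?mulr_ge0 // ltW.
have C2 : 0 <= 2 * C' by exact: mulr_ge0.
have a2 : 0 <= 2 * a by exact: mulr_ge0.
have b0 : 0 <= b by do 2 apply: addr_ge0 => //.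
apply: (theta_bounded_inB theta x0 theta_nneg theta_lim a b psi b0 _).1; split => // m.
have osc2a := osc_le_sup m psi a pa.
case: m osc2a => [|m] osc2a.
  by apply: osc_le_trans osc2a _; rewrite expr0 mulr1 /b addrA lerDr addr_ge0.
have [Dm|Dm] := leP (D * theta m.+2) 2^-1.
  apply: osc_le_trans (high m.+1 isT Dm) _.
  by rewrite ler_wpM2r // lerDl addr_ge0.
have mM1 : (m.+1 < M1)%N.
  rewrite ltnNge; apply/negP => /M1P; rewrite invfM mulrC.
  by rewrite ler_pdivlMl // leNgt Dm.
have tm : theta m.+2 ^+ m.+1 != 0.
  rewrite expf_neq0 //; apply: contraTneq Dm => ->.
  by rewrite mulr0 -leNgt invr_ge0.
apply: osc_le_trans osc2a _.
apply: (@le_trans _ _ (2 * a / d * theta m.+2 ^+ m.+1)).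
  by rewrite mulrAC ler_pdivlMr // ler_wpM2l ?mulr_ge0 // dP.
by rewrite ler_wpM2r // /b addrCA lerDl addr_ge0.
Qed.

End Compactness.

(** * A base point, and the passage between V and B *)

(** A positive power forces every row of [A] to contain a 1, and iterating a choice of successors
    yields a point. It becomes the base point [x0]. *)
Lemma SigmaA_inhabited (N : nat) (A : 'M[int]_N) :
  (0 < N)%N -> zero_one_mx A -> aperiodic_mx A -> inhabited (SigmaA A).
Proof.
move=> N0 A01 [[|k] [k0 Ak]]; first by [].
have next i : exists j, A i j = 1.
  apply: contrapT => no.
  have := Ak i (Ordinal N0); rewrite exprS -[A * _]/(A *m _) mxE big1 ?ltxx // => j _.
  by case: (A01 i j) => [->|Aij]; [rewrite mul0r|case: no; exists j].
have [s sP] := choice next.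
have adm : `[< admissible A (fun n => iter n s (Ordinal N0)) >].
  by apply/asboolP => m; exact: sP.
by constructor; exists (fun n => iter n s (Ordinal N0)).
Qed.

(** From [S^k psi = 0], with [S = lam - L], the regularity hypothesis pulls membership in B back
    through the powers to [psi]. *)
Lemma gen_eigenspace_inV_inB (R : realType) (N : nat) (A : 'M[int]_N)
    (theta : nat -> R) (f : SigmaA A -> R[i]) (lam : R[i]) :
  (forall psi, inV psi -> inV (shifted (transfer f) lam psi)) ->
  (forall psi, inV psi -> inB theta (shifted (transfer f) lam psi) -> inB theta psi) ->
  inB theta (fun _ : SigmaA A => 0) ->
  gen_eigenspace (@inV R N A) (transfer f) lam = gen_eigenspace (inB theta) (transfer f) lam.
Proof.
move=> SV BS B0; apply/funext => psi; apply/propext.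
split => -[Vpsi [k kP]]; split; try (by exists k); last by case: Vpsi.
have : inB theta (iter k (shifted (transfer f) lam) psi) by rewrite [iter _ _ _]kP.
elim: k psi Vpsi {kP} => // k IH psi Vpsi; rewrite iterSr => /IH h.
by apply: BS => //; apply: h; exact: SV.
Qed.

Theorem theorem1p1 (R : realType) (N : nat) (A : 'M[int]_N)
  (HN : (2 <= N)%N) (HA01 : zero_one_mx A) (HAap : aperiodic_mx A)
  (f : SigmaA A -> R[i]) (hfV : inV f)
  (theta : nat -> R)
  (htheta_mono : forall m : nat, (0 < m)%N -> theta m.+1 <= theta m)
  (htheta_nneg : forall m : nat, (0 < m)%N -> 0 <= theta m)
  (htheta_lim : theta @ \oo --> (0 : R))
  (hf : forall m : nat, (0 < m)%N -> (var m f <= ((theta m) ^+ m)%:E)%E) :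
  ((forall phi, inB theta phi -> inB theta (transfer f phi)) /\
   compact_op (inB theta) (normB theta) (transfer f)) /\
  ((forall lam : R[i], nz_eigenvalue (@inV R N A) (transfer f) lam <->
       (lam != 0 /\ spectrum (inB theta) (normB theta) (transfer f) lam)) /\
   (forall lam : R[i], nz_eigenvalue (@inV R N A) (transfer f) lam ->
      exists d : nat,
        eig_multiplicity (@inV R N A) (transfer f) lam d /\
        eig_multiplicity (inB theta) (transfer f) lam d)).
Proof.
have [x0] := @SigmaA_inhabited N A (ltnW HN) HA01 HAap.
have [F [_ f_le]] := inV_bounded x0 f hfV.
have f_osc m : osc_le m.+1 f (theta m.+1 ^+ m.+1) by apply/var_leP; exact: hf.
pose G := N%:R * (3 * expR F).
have G0 : 0 <= G by exact: transfer_const_ge0.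
have TB phi : inB theta phi -> inB theta (transfer f phi).
  exact: (inB_transfer theta x0 htheta_mono htheta_nneg htheta_lim f F).
have Tc : compact_op (inB theta) (normB theta) (transfer f).
  exact: (transfer_compact theta x0 htheta_mono htheta_nneg htheta_lim f F).
have BS lam psi : lam != 0 -> inV psi ->
    inB theta (shifted (transfer f) lam psi) -> inB theta psi.
  exact: (inB_of_shifted theta x0 htheta_mono htheta_nneg htheta_lim f F).
have Blin := inB_lin2 theta x0 htheta_nneg htheta_lim.
have Tlin := transfer_lin2 f.
have B0 : inB theta (fun _ : SigmaA A => 0).
  have h : theta_bounded theta 0 0 (fun _ : SigmaA A => 0).
    by split => [x|m w w' _]; rewrite ?subrr cnorm0 // mul0r.
  exact: (theta_bounded_inB theta x0 htheta_nneg htheta_lim 0 0 _ (lexx _) h).1.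
have SV lam psi : inV psi -> inV (shifted (transfer f) lam psi).
  move=> Vpsi; rewrite (_ : shifted _ _ _ = lin2 lam psi (-1) (transfer f psi)).
    by apply: inV_lin2 => //; exact: (inV_transfer f F f_le x0).
  by apply/funext => x; rewrite /lin2 /shifted mulN1r.
have shifted0 lam phi : (forall x, transfer f phi x = lam * phi x) ->
    shifted (transfer f) lam phi = fun=> 0.
  by move=> h; apply/funext => x; rewrite /shifted h subrr.
(* Truncated levels, so that all functions of the sampled words belong to B. *)
pose D m : finType := {ffun 'I_(level theta m) -> 'I_N}.
pose r m : D m -> SigmaA A := cylinder_point x0 (level theta m).
pose code m : SigmaA A -> D m := word (level theta m).
split; first by split.
split => [lam|lam [lam0 _]].
- split => [[lam0 [phi [Vphi [[x phix] phiE]]]]|[lam0 spec]]; split => //.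
    (* A resolvent would send 0 to the eigenfunction, contrary to its norm bound. *)
    move=> [S [_ [[K SK] [SL _]]]].
    have phi0 := shifted0 lam phi phiE.
    have Bphi : inB theta phi by apply: BS lam0 Vphi _; rewrite phi0.
    have phiS : phi = S (fun=> 0) by rewrite -phi0 SL.
    move/negP : phix; apply; apply/eqP/cnorm_eq0.
    apply: le_trans (le_normB theta x0 htheta_nneg phi Bphi x) _.
    rewrite [in leLHS]phiS; apply: le_trans (SK _ B0) _.
    rewrite (_ : normB theta _ = 0) ?mulr0 //.
    exact: (nrm_zero (inB theta) (normB theta) (normB_ge0 theta x0)
      (normB_lin2 theta x0 htheta_nneg htheta_lim) _ B0 (fun=> erefl)).
  have : ~ injective_on (inB theta) (shifted (transfer f) lam).
    move=> inj; apply/spec.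
    apply: (resolvent_of_injective (inB theta) (normB theta) (transfer f) G lam D r code
      (fun m => theta (level theta m).+1 ^+ level theta m) Blin (normB_ge0 theta x0)
      (normB_lin2 theta x0 htheta_nneg htheta_lim) (le_normB theta x0 htheta_nneg) Tlin
      (fun a phi => transfer_sup f F f_le phi a) TB Tc lam0 _ _ _
      (level_weights_null theta htheta_nneg htheta_lim) inj).
    - by move=> m v; exact: (inB_word theta x0).
    - by move=> m phi; exact: (normB_sample theta x0).
    - by move=> m phi x; exact: (sample_approx theta x0).
  move=> ninj; apply: contrapT => no; apply: ninj => phi Bphi phi0 x.
  apply/eqP; apply: contrapT => /negP px; apply: no; exists phi.
  split; first by case: Bphi.
  split; first by exists x.
  by move=> y; have /eqP := phi0 y; rewrite /shifted subr_eq0 => /eqP.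
- have [|d dP] := gen_eigenspace_has_dim (inB theta) (normB theta) (transfer f) G lam D r code
      (fun m => theta (level theta m).+1 ^+ level theta m) Blin (normB_ge0 theta x0)
      (normB_lin2 theta x0 htheta_nneg htheta_lim) (le_normB theta x0 htheta_nneg) Tlin
      G0 (fun a phi => transfer_sup f F f_le phi a) TB Tc lam0 _
      (level_weights_null theta htheta_nneg htheta_lim).
    by move=> m phi x; exact: (sample_approx theta x0).
  exists d; split => //; rewrite /eig_multiplicity (@gen_eigenspace_inV_inB _ _ _ theta) //.
    exact: SV.
  by move=> psi; exact: BS.
Qed.
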